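(* Let $d\ge 2$ be an integer, $p=d-1$, $\lambda>0$ and $u>0$, and let $\mathbf N\sim\mathrm{NDFHL}^{(d)}(\lambda,u)$ with differential entropy $h(\mathbf N)$. For $P>0$ let $$C(P)=\sup_{P_{\mathbf X}:\ \mathbb E\|\mathbf X\|^2\le P} I(\mathbf X;\mathbf X+\mathbf N),$$ the supremum being over distributions of $\mathbf X\in\mathbb R^p$ independent of $\mathbf N$. Then, as $P\to\infty$, $$C(P)=\frac p2\log P+c^*+o(1),\qquad c^*=\frac p2\log\!\left(\frac{2\pi e}{p}\right)-h(\mathbf N).$$
   Context: For an integer $d\ge2$, $p=d-1$, $\lambda>0$, $u>0$, the distribution $\mathrm{NDFHL}^{(d)}(\lambda,u)$ is the probability law on $\mathbb R^{p}$ with density $$f_{\mathbf N}(\mathbf n)=\frac{\lambda}{2^{\frac d2-1}\pi^{\frac d2}}\left(\frac{u}{\rho(\mathbf n)}\right)^{\frac d2}e^{\lambda u}K_{\frac d2}\bigl(u\rho(\mathbf n)\bigr),\qquad \rho(\mathbf n)=\sqrt{\|\mathbf n\|^2+\lambda^2},$$ where $K_\nu$ is the modified Bessel function of the second kind. Equivalently, it is the law of $\sigma\sqrt{T}\,\mathbf Z$ where $\sigma>0$, $\mathbf Z\sim\mathcal N(\mathbf 0,\mathbf I_p)$ is independent of $T$, and $T$ is inverse Gaussian with mean $\lambda/(u\sigma^2)$ and shape parameter $\lambda^2/\sigma^2$. All logarithms are natural. *)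

(* Defs.v *)
(* R : realType, R^p represented as p.-tuple R
   (with the product = Borel sigma-algebra from measurable_structure.v). *)
From HB Require Import structures.
From mathcomp Require Import all_boot all_order all_algebra.
From mathcomp Require Import all_classical all_reals all_analysis.
Set Implicit Arguments.
Unset Strict Implicit.
Unset Printing Implicit Defensive.
Import Order.TTheory GRing.Theory Num.Theory.
Import numFieldNormedType.Exports.
Local Open Scope classical_set_scope.
Local Open Scope ring_scope.

Definition coshR {R : realType} (t : R) : R := (expR t + expR (- t)) / 2.

(* Modified Bessel function of the second kind, via the standard integral
   representation  K_nu(x) = \int_0^oo exp(-x cosh t) cosh(nu t) dt  (x > 0). *)
Definition besselK {R : realType} (nu x : R) : R :=
  fine (\int[@lebesgue_measure R]_(t in `[0%R, +oo[)
          (expR (- (x * coshR t)) * coshR (nu * t))%:E)%E.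

Definition normsq {R : realType} {p : nat} (x : p.-tuple R) : R :=
  \sum_(i < p) tnth x i ^+ 2.

Definition tsub {R : realType} {p : nat} (y x : p.-tuple R) : p.-tuple R :=
  [tuple tnth y i - tnth x i | i < p].

(* Lebesgue (outer) measure on R^p: infimum of the total volume of countable
   covers by closed boxes [a_k, b_k]; restricted to Borel sets it is the
   p-dimensional Lebesgue measure. *)
Definition box {R : realType} {p : nat} (a b : p.-tuple R) : set (p.-tuple R) :=
  [set x | forall i : 'I_p, tnth a i <= tnth x i <= tnth b i].

Definition boxvol {R : realType} {p : nat} (a b : p.-tuple R) : R :=
  \prod_(i < p) (tnth b i - tnth a i).

Definition lebesgue_p {R : realType} {p : nat} (A : set (p.-tuple R)) : \bar R :=
  ereal_inf [set (\sum_(k <oo) (boxvol (ab.1 k) (ab.2 k))%:E)%E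
            | ab in [set ab : (nat -> p.-tuple R) * (nat -> p.-tuple R) |
                 (forall k (i : 'I_p), tnth (ab.1 k) i <= tnth (ab.2 k) i) /\
                 A `<=` \bigcup_k box (ab.1 k) (ab.2 k)]].

Definition ndfhl_density {R : realType} (d : nat) (lam u : R)
    (n : (d.-1).-tuple R) : R :=
  let rho := Num.sqrt (normsq n + lam ^+ 2) in
  let hd := d%:R / 2 in
  lam / (2 `^ (hd - 1) * pi `^ hd) * (u / rho) `^ hd * expR (lam * u)
    * besselK hd (u * rho).

Definition diff_entropy {R : realType} {p : nat} (f : p.-tuple R -> R) : \bar R :=
  (- \int[@lebesgue_p R p]_x (f x * ln (f x))%:E)%E.

(* Additive noise channel Y = X + N, X ~ PX independent of N, N with density f:
   the output density  f_Y(y) = E[f(y - X)] ... *)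
Definition out_density {R : realType} {p : nat} (f : p.-tuple R -> R)
    (PX : probability (p.-tuple R) R) (y : p.-tuple R) : R :=
  fine (\int[PX]_x (f (tsub y x))%:E)%E.

(* ... and the mutual information
   I(X; X+N) = E_X [ \int f(y-X) log (f(y-X) / f_Y(y)) dy ]
   (= D(P_{XY} || P_X x P_Y) written with the conditional density f(y-x)). *)
Definition mutual_info_additive {R : realType} {p : nat} (f : p.-tuple R -> R)
    (PX : probability (p.-tuple R) R) : \bar R :=
  (\int[PX]_x
     \int[@lebesgue_p R p]_y
        (f (tsub y x) * ln (f (tsub y x) / out_density f PX y))%:E)%E.

Definition capacity {R : realType} {p : nat} (f : p.-tuple R -> R) (P : R) : \bar R :=
  ereal_sup [set mutual_info_additive f PX |
    PX in [set PX : probability (p.-tuple R) R |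
             (\int[PX]_x (normsq x)%:E <= P%:E)%E]].

(* Main.v *)
(* The noise density is a mixture of centred Gaussian densities,
     f x = \int w t exp(- (u/2) e^t |x|^2) dt,
   obtained from the integral representation of K_nu by translating t by
   ln rho; Tonelli's theorem then yields total mass 1 and a finite second
   moment c, and f lies between k exp(- C |x|^2) and a constant M.
   Writing q for the output density, I(X; X + N) = - h(N) - \int q ln q.
   Upper bound: Gibbs' inequality for q against the Gaussian density of
   variance P/p, together with E|X + N|^2 <= (1 + e) P + (1 + 1/e) c.
   Lower bound: for Gaussian X of variance P/p, h(X + N) >= h(X), again by
   Gibbs' inequality, between the law of X and each translate of q.
   The difference of the two bounds is (p/2) (e + (1 + 1/e) c / P). *)
Require Import Defs.
From HB Require Import structures.
From mathcomp Require Import all_boot all_order all_algebra.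
From mathcomp Require Import all_classical all_reals all_analysis.
From mathcomp Require Import measurable_realfun ring lra.
Import Order.TTheory GRing.Theory Num.Theory.
Import numFieldNormedType.Exports.
Local Open Scope classical_set_scope.
Local Open Scope ring_scope.

(** * Lebesgue measure on tuples *)

(** [lebesgue_p] is only an infimum over covers by closed boxes, which by itself gives neither
    Tonelli nor translation invariance. The measure [tleb] is therefore built as an iterated
    product, shown equal to [lebesgue_p] on Borel sets in positive dimension, and used in all later
    integrals. The second obstacle is that entropy integrands change sign. A noise density bounded
    by M makes every output density q bounded by M, so ln (M / q) is nonnegative: replacing - ln q
    by it costs only the constant ln M and lets Tonelli exchange integrals. The lower bound on f
    makes ln f and ln q at most quadratic, so a finite second moment suffices for finite entropies.
    The cross term in E|X + N|^2 is absorbed by a weighted square inequality rather than computed;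
    its parameter e is fixed first and P is taken large afterwards. *)

Section product_lebesgue.
Context {R : realType}.
Implicit Types n : nat.

Definition tcons {n} (xv : R * n.-tuple R) : n.+1.-tuple R :=
  [tuple of xv.1 :: xv.2].

Lemma measurable_tcons n : measurable_fun [set: R * n.-tuple R] (@tcons n).
Proof. exact: measurable_cons. Qed.

Definition tleb_step n (m : {sigma_finite_measure set (n.-tuple R) -> \bar R}) :
    set (n.+1.-tuple R) -> \bar R :=
  pushforward (product_measure1 (@lebesgue_measure R) m) (@tcons n).

Section step.
Context {n : nat} (m : {sigma_finite_measure set (n.-tuple R) -> \bar R}).

Let tleb_step_measure : {measure set (n.+1.-tuple R) -> \bar R} :=
  measure_function_pushforward__canonical__measure_function_Measure
    (product_measure1 (@lebesgue_measure R) m : {measure set _ -> \bar R})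
    (@measurable_tcons n).

HB.instance Definition _ := isMeasure.Build _ _ _ (tleb_step _ m)
  (measure0 tleb_step_measure) (measure_ge0 tleb_step_measure)
  (@measure_semi_sigma_additive _ _ _ tleb_step_measure).

Let sigma_finite_tleb_step : sigma_finite setT (tleb_step _ m).
Proof.
pose unc (v : n.+1.-tuple R) : R * n.-tuple R := (thead v, [tuple of behead v]).
have consK x : unc (tcons x) = x.
  by case: x => x v; rewrite /unc/tcons/= theadE; congr pair; apply/val_inj.
have munc : measurable_fun setT unc.
  apply/measurable_fun_pair; last exact: measurable_behead.
  exact: measurable_tnth.
have /sigma_finiteP[F [TF ndF Foo]] := sigma_finiteT (@lebesgue_measure R).
have /sigma_finiteP[G [TG ndG Goo]] := sigma_finiteT m.
(* Rectangles are transported through [unc], the inverse of [tcons]. Both sequences are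
   nondecreasing, so a common index reaches any given point. *)
exists (fun k => unc @^-1` (F k `*` G k)).
  rewrite -preimage_bigcup; apply/esym; rewrite -subTset => v _ /=.
  have [k _ Fk] : (\bigcup_k F k) (unc v).1 by rewrite -TF.
  have [l _ Gl] : (\bigcup_k G k) (unc v).2 by rewrite -TG.
  exists (maxn k l) => //; split.
  - by move: (unc v).1 Fk; exact/subsetPset/ndF/leq_maxl.
  - by move: (unc v).2 Gl; exact/subsetPset/ndG/leq_maxr.
move=> k; have [mF Fk] := Foo k; have [mG Gk] := Goo k; split.
  by rewrite -[X in measurable X]setTI; apply: munc => //; exact: measurableX.
rewrite /tleb_step /pushforward -comp_preimage.
rewrite (_ : unc \o tcons = id); last by apply/funext => x /=; rewrite consK.
by rewrite preimage_id product_measure1E// lte_mul_pinfty// ge0_fin_numE.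
Qed.

HB.instance Definition _ :=
  Measure_isSigmaFinite.Build _ _ _ (tleb_step _ m) sigma_finite_tleb_step.
End step.

(** Dimension 0 carries the unit mass at the empty tuple, so that inductions over coordinates start
    from the value 1 of an empty product. *)
Fixpoint tleb n : {sigma_finite_measure set (n.-tuple R) -> \bar R} :=
  match n with
  | 0 => \d_[tuple]
  | n.+1 => tleb_step n (tleb n)
  end.

Local Open Scope ereal_scope.

Lemma integral_tlebS n (F : n.+1.-tuple R -> \bar R) :
  measurable_fun setT F -> (forall x, 0 <= F x) ->
  \int[tleb n.+1]_x F x =
  \int[lebesgue_measure]_x \int[tleb n]_v F (tcons (x, v)).
Proof.
move=> mF F0; rewrite ge0_integral_pushforward//=; last exact: measurable_tcons.
rewrite preimage_setT fubini_tonelli1//=.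
by apply: measurableT_comp => //; exact: measurable_tcons.
Qed.

Lemma integral_tleb0 (F : 0.-tuple R -> \bar R) :
  measurable_fun setT F -> \int[tleb 0]_x F x = F [tuple].
Proof. by move=> mF; rewrite integral_dirac//= diracT mul1e. Qed.

Lemma measurable_tsub n :
  measurable_fun setT (fun yx : n.-tuple R * n.-tuple R => tsub yx.1 yx.2).
Proof.
apply/measurable_fun_tnthP => i.
rewrite (_ : _ \o _ = fun yx : n.-tuple R * n.-tuple R => tnth yx.1 i - tnth yx.2 i)%R.
  apply: measurable_funB.
    exact: (measurableT_comp (measurable_tnth i) measurable_fst).
  exact: (measurableT_comp (measurable_tnth i) measurable_snd).
by apply/funext => yx /=; rewrite tnth_mktuple.
Qed.

Lemma measurable_tsubl n (b : n.-tuple R) :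
  measurable_fun setT (fun x : n.-tuple R => tsub x b).
Proof. exact: (measurableT_comp (measurable_tsub n) (pair2_measurable b)). Qed.

(** The image of Lebesgue measure under a translation has the right value on the intervals []b, c]],
    so it is Lebesgue measure by uniqueness. *)
Lemma ge0_integral_lebesgue_shift (f : R -> \bar R) (a : R) :
  measurable_fun setT f -> (forall x, 0 <= f x) ->
  \int[lebesgue_measure]_x f (x - a)%R = \int[lebesgue_measure]_x f x.
Proof.
move=> mf f0.
pose phi (x : measurableTypeR R) : measurableTypeR R := (x - a)%R.
have mphi : measurable_fun setT phi by exact: measurable_funB.
pose m : {measure set (measurableTypeR R) -> \bar R} :=
  measure_function_pushforward__canonical__measure_function_Measure
    (@lebesgue_measure R : {measure set _ -> \bar R}) mphi.
transitivity (\int[m]_x f x).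
  by rewrite ge0_integral_pushforward.
apply: eq_measure_integral => A mA _; apply/esym.
apply: lebesgue_measure_unique => // _ [[b c] _ <-] /=.
rewrite /m/=/pushforward.
rewrite (_ : phi @^-1` _ = `](b + a)%R, (c + a)%R]%classic).
  rewrite !lebesgue_measure_itv/= !lte_fin ltrD2r; case: ifPn => // _.
  by rewrite -!EFinB; congr EFin; ring.
by apply/seteqP; split => x; rewrite /phi/= !in_itv/= ltrBrDr lerBlDr.
Qed.

Lemma tsub_tcons n x y (v w : n.-tuple R) :
  tsub (tcons (x, v)) (tcons (y, w)) = tcons ((x - y)%R, tsub v w).
Proof.
apply: eq_from_tnth => i; rewrite tnth_mktuple.
by case: (unliftP ord0 i) => [j ->|->]; rewrite /tcons/= ?tnthS ?tnth_mktuple ?tnth0.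
Qed.

Lemma tuple_tcons n (v : n.+1.-tuple R) : exists xv, v = tcons xv.
Proof.
case/tupleP: v => x v; exists (x, v).
by apply/val_inj.
Qed.

Lemma integral_tleb_shift n (F : n.-tuple R -> \bar R) (a : n.-tuple R) :
  measurable_fun setT F -> (forall x, 0 <= F x) ->
  \int[tleb n]_x F (tsub x a) = \int[tleb n]_x F x.
Proof.
elim: n F a => [|n IH] F a mF F0.
  rewrite !integral_tleb0//; last exact: (measurableT_comp mF (measurable_tsubl _ _)).
  by congr F; exact: tuple0.
have [[b w] ->] := tuple_tcons n a.
rewrite !integral_tlebS//; last exact: (measurableT_comp mF (measurable_tsubl _ _)).
under eq_integral do under eq_integral do rewrite tsub_tcons.
have mFc : measurable_fun setT (F \o tcons).
  by apply: measurableT_comp => //; exact: measurable_tcons.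
have E x : \int[tleb n]_v F (tcons ((x - b)%R, tsub v w)) =
           \int[tleb n]_v F (tcons ((x - b)%R, v)).
  apply: (IH (fun v => F (tcons ((x - b)%R, v)))) => //.
  exact: (measurableT_comp mFc (pair1_measurable _)).
under eq_integral do rewrite E.
rewrite (ge0_integral_lebesgue_shift (fun x => \int[tleb n]_v F (tcons (x, v))))//.
  exact: (@measurable_fun_fubini_tonelli_F _ _ _ _ _ (tleb n) (F \o tcons) mFc (fun x => F0 _)).
by move=> x; exact: integral_ge0.
Qed.

End product_lebesgue.

(** * The box-covering outer measure agrees with the product measure *)

Section lebesgue_p_tleb.
Context {R : realType}.
Implicit Types n : nat.
Local Open Scope ereal_scope.

Lemma measurable_box n (a b : n.-tuple R) : measurable (box a b).
Proof.
rewrite (_ : box a b = \bigcap_(i in [set: 'I_n])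
    ((fun x : n.-tuple R => tnth x i) @^-1` `[tnth a i, tnth b i]%classic)).
  apply: fin_bigcap_measurable => // i _.
  by rewrite -[X in measurable X]setTI; exact: measurable_tnth.
apply/seteqP; split => x /=; first by move=> h i _; rewrite /= in_itv/=; exact: h.
by move=> h i; have := h i Logic.I; rewrite /= in_itv.
Qed.

Lemma tleb_box n (a b : n.-tuple R) : (forall i, tnth a i <= tnth b i)%R ->
  tleb n (box a b) = (boxvol a b)%:E.
Proof.
elim: n a b => [|n IH] a b ab.
  by rewrite /= diracE /boxvol big_ord0 mem_set// => -[].
have [[a0 v] ea] := tuple_tcons n a; have [[b0 w] eb] := tuple_tcons n b.
have c0 (x0 : R) (x : n.-tuple R) : tnth (tcons (x0, x)) ord0 = x0 by [].
have cS (x0 : R) (x : n.-tuple R) i : tnth (tcons (x0, x)) (lift ord0 i) = tnth x i.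
  by rewrite /tcons/= tnthS.
subst a b.
have ab0 : (a0 <= b0)%R by have := ab ord0; rewrite !c0.
have vw i : (tnth v i <= tnth w i)%R by have := ab (lift ord0 i); rewrite !cS.
rewrite /= /tleb_step /pushforward.
rewrite (_ : tcons @^-1` _ = `[a0, b0]%classic `*` box v w); last first.
  apply/seteqP; split => -[x y] /=.
    move=> h; split; first by have := h ord0; rewrite !c0/= in_itv.
    by move=> i; have := h (lift ord0 i); rewrite !cS.
  move=> [+ h] i; rewrite /= in_itv/= => h0.
  by case: (unliftP ord0 i) => [j ->|->]; rewrite ?cS ?c0.
rewrite product_measure1E//; last exact: measurable_box.
rewrite IH//= lebesgue_measure_itv/= lte_fin /boxvol big_ord_recl/= !c0.
rewrite EFinM; congr (_ * _).
  case: ifPn; first by rewrite EFinB.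
  by rewrite -leNgt => ba; rewrite (@le_anti _ _ a0 b0) ?ab0// subrr.
by congr EFin; apply: eq_bigr => i _; rewrite !cS.
Qed.

Lemma boxvol_ge0 n (a b : n.-tuple R) : (forall i, tnth a i <= tnth b i)%R ->
  (0 <= boxvol a b)%R.
Proof. by move=> ab; apply: prodr_ge0 => i _; rewrite subr_ge0. Qed.

(** One half of the comparison: countable subadditivity of [tleb] over any cover by boxes. *)
Lemma tleb_le_lebesgue_p n (A : set (n.-tuple R)) : measurable A ->
  tleb n A <= lebesgue_p A.
Proof.
move=> mA; apply: le_ereal_inf_tmp => _ /= [ab [abP Aab] <-].
rewrite (eq_eseriesr (g := fun k => tleb n (box (ab.1 k) (ab.2 k)))); last first.
  by move=> k _; rewrite tleb_box.
by apply: measure_sigma_subadditive => // k; exact: measurable_box.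
Qed.

(* Sets that are not closed boxes have infinite cost: this makes the library's
   outer measure [mu_ext], which covers by arbitrary measurable sets, agree with
   covering by closed boxes (which do not form a semiring of sets). *)
Definition boxm n (A : set (n.-tuple R)) : \bar R :=
  if `[< A = set0 \/ exists a b : n.-tuple R,
           (forall i, (tnth a i <= tnth b i)%R) /\ A = box a b >]
  then tleb n A else +oo.

Lemma boxm0 n : boxm n set0 = 0.
Proof. by rewrite /boxm asboolT ?measure0//; left. Qed.

Lemma boxm_ge0 n A : 0 <= boxm n A.
Proof. by rewrite /boxm; case: ifPn. Qed.

Lemma boxm_box n (a b : n.-tuple R) : (forall i, tnth a i <= tnth b i)%R ->
  boxm n (box a b) = (boxvol a b)%:E.
Proof.
move=> ab; rewrite /boxm asboolT ?tleb_box//.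
by right; exists a, b.
Qed.

(** An empty piece of a cover is replaced by a one-point box of volume 0, which exists only in
    positive dimension. In dimension 0 every box has volume 1, so an infinite sequence of boxes
    costs +oo and even the empty set would get [lebesgue_p] equal to +oo. *)
Lemma lebesgue_pE n (A : set (n.+1.-tuple R)) : lebesgue_p A = mu_ext (boxm n.+1) A.
Proof.
apply/eqP; rewrite eq_le; apply/andP; split; apply: le_ereal_inf_tmp => z /=.
- move=> [F [mF AF] <-].
  have [[k Fk]|nF] := pselect (exists k, boxm n.+1 (F k) = +oo).
    rewrite (eseries_pinfty _ _ Fk) ?leey// => m _.
    by rewrite -ltNye (lt_le_trans _ (boxm_ge0 _ _)).
  have [ab abP] : {ab : nat -> n.+1.-tuple R * n.+1.-tuple R & forall k,
      [/\ forall i, (tnth (ab k).1 i <= tnth (ab k).2 i)%R,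
        F k `<=` box (ab k).1 (ab k).2 &
        (boxvol (ab k).1 (ab k).2)%:E = boxm n.+1 (F k)]}.
    apply: (@choice _ _ (fun k (ab : n.+1.-tuple R * n.+1.-tuple R) =>
      [/\ forall i, (tnth ab.1 i <= tnth ab.2 i)%R, F k `<=` box ab.1 ab.2 &
          (boxvol ab.1 ab.2)%:E = boxm n.+1 (F k)])) => k.
    have [Fk|] := boolP `[< F k = set0 \/ exists a b : n.+1.-tuple R,
           (forall i, (tnth a i <= tnth b i)%R) /\ F k = box a b >]; last first.
      move=> h; case: nF; exists k; by rewrite /boxm (negbTE h).
    move/asboolP : Fk => [->|[a [b [ab ->]]]]; last first.
      by exists (a, b); split => //; rewrite boxm_box.
    exists ([tuple 0%R | i < n.+1], [tuple 0%R | i < n.+1]); split => //=.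
    by rewrite boxm0 /boxvol big_ord_recl subrr mul0r.
  rewrite (eq_eseriesr (g := fun k => (boxvol (ab k).1 (ab k).2)%:E)); last first.
    by move=> k _; have [] := abP k.
  apply: ereal_inf_lbound; exists (fst \o ab, snd \o ab) => //=; split.
    by move=> k i; have [] := abP k.
  by move=> x /AF [k _ Fkx]; exists k => //=; have [_ + _] := abP k; exact.
- move=> [ab [abP Aab] <-].
  rewrite (eq_eseriesr (g := fun k => boxm n.+1 (box (ab.1 k) (ab.2 k)))); last first.
    by move=> k _; rewrite boxm_box.
  apply: ereal_inf_lbound; exists (fun k => box (ab.1 k) (ab.2 k)) => //; split => //.
  by move=> k; exact: measurable_box.
Qed.

Section outer.
Variable n : nat.
Local Notation T := (n.+1.-tuple R).

Let lebesgue_p0 : @lebesgue_p R n.+1 set0 = 0.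
Proof. by rewrite lebesgue_pE mu_ext0 ?boxm0//; exact: boxm_ge0. Qed.

Let lebesgue_p_ge0 (A : set T) : 0 <= lebesgue_p A.
Proof. by rewrite lebesgue_pE mu_ext_ge0//; exact: boxm_ge0. Qed.

Let le_lebesgue_p : {homo @lebesgue_p R n.+1 : A B / A `<=` B >-> A <= B}.
Proof. by move=> A B AB; rewrite !lebesgue_pE; exact: le_mu_ext. Qed.

Let lebesgue_p_sigma_subadditive : sigma_subadditive (@lebesgue_p R n.+1).
Proof.
move=> F; rewrite lebesgue_pE.
rewrite (eq_eseriesr (g := fun i => mu_ext (boxm n.+1) (F i))); last first.
  by move=> i _; rewrite lebesgue_pE.
by apply: mu_ext_sigma_subadditive; exact: boxm_ge0.
Qed.

HB.instance Definition _ := isOuterMeasure.Build R T (@lebesgue_p R n.+1)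
  lebesgue_p0 lebesgue_p_ge0 le_lebesgue_p lebesgue_p_sigma_subadditive.

End outer.

Definition tset n (i : 'I_n) (c : R) (a : n.-tuple R) : n.-tuple R :=
  [tuple if j == i then c else tnth a j | j < n].

Lemma boxvol_split n (i : 'I_n) (a b : n.-tuple R) (c : R) :
  (boxvol a (tset _ i c b) + boxvol (tset _ i c a) b = boxvol a b)%R.
Proof.
rewrite /boxvol (bigD1 i)//= [X in (_ + X)%R](bigD1 i)//= [RHS](bigD1 i)//=.
rewrite !tnth_mktuple eqxx.
rewrite (eq_bigr (fun j => tnth b j - tnth a j)%R); last first.
  by move=> j /negbTE ji; rewrite tnth_mktuple ji.
rewrite [X in (_ + _ * X)%R](eq_bigr (fun j => tnth b j - tnth a j)%R); last first.
  by move=> j /negbTE ji; rewrite tnth_mktuple ji.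
rewrite -mulrDl; congr (_ * _)%R; ring.
Qed.

(** The hyperplane cuts each box of a cover into two boxes whose volumes add up; the two families
    cover the two parts of X. The halves share a face, which does no harm since only covers are
    needed. *)
Lemma caratheodory_halfspace n (i : 'I_n.+1) (t : R) :
  (@lebesgue_p R n.+1).-caratheodory [set x | (t < tnth x i)%R].
Proof.
apply: le_caratheodory_measurable => X.
apply: le_ereal_inf_tmp => _ /= [ab [abP Xab] <-].
(* The threshold t clamped to the i-th side of the box, so that both halves are genuine, possibly
   degenerate, boxes. *)
pose c k := Num.min (tnth (ab.2 k) i) (Num.max (tnth (ab.1 k) i) t).
have cP k : (tnth (ab.1 k) i <= c k <= tnth (ab.2 k) i)%R.
  by rewrite /c ge_min lexx/= le_min abP le_max lexx.
rewrite (eq_eseriesr (g := fun k => (boxvol (tset _ i (c k) (ab.1 k)) (ab.2 k))%:E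
   + (boxvol (ab.1 k) (tset _ i (c k) (ab.2 k)))%:E)); last first.
  by move=> k _; rewrite -EFinD addrC boxvol_split.
have lo k j : (tnth (ab.1 k) j <= tnth (tset _ i (c k) (ab.2 k)) j)%R.
  by rewrite tnth_mktuple; case: eqP => [->|//]; have /andP[] := cP k.
have hi k j : (tnth (tset _ i (c k) (ab.1 k)) j <= tnth (ab.2 k) j)%R.
  by rewrite tnth_mktuple; case: eqP => [->|//]; have /andP[] := cP k.
rewrite nneseriesD; [|by move=> k _ _; rewrite lee_fin boxvol_ge0..].
apply: leeD; apply: ereal_inf_lbound => /=.
- exists (fun k => tset _ i (c k) (ab.1 k), ab.2) => //; split => //.
  move=> x [Xx /= tx]; have [k _ kx] := Xab _ Xx; exists k => //= j.
  have /andP[h1 h2] := kx j.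
  rewrite tnth_mktuple; case: eqP => [ji|_]; last by rewrite h1.
  by rewrite h2 andbT ji in h1 * ; rewrite /c ge_min ge_max h1 (ltW tx) orbT.
- exists (ab.1, fun k => tset _ i (c k) (ab.2 k)) => //; split => //.
  move=> x [Xx /= /negP]; rewrite -leNgt => tx.
  have [k _ kx] := Xab _ Xx; exists k => //= j.
  have /andP[h1 h2] := kx j.
  rewrite tnth_mktuple; case: eqP => [ji|_]; last by rewrite h1.
  by rewrite h1/= ji in h2 *; rewrite /c le_min h2/= le_max tx orbT.
Qed.

(** A closed half-space is a countable union of boxes, so the coordinates are measurable for the
    sigma-algebra that boxes generate. *)
Lemma measurable_tuple_boxes n :
  measurable = <<s [set box ab.1 ab.2 | ab in [set: n.-tuple R * n.-tuple R]] >>.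
Proof.
set G := [set _ | _ in _].
apply/seteqP; split; last first.
  apply: smallest_sub; first exact: sigma_algebra_measurable.
  by move=> _ [ab _ <-]; exact: measurable_box.
have mid : measurable_fun setT (id : g_sigma_algebraType G -> n.-tuple R).
  apply/measurable_fun_tnthP => i.
  apply: (measurability _ (RGenCInfty.measurableE R)) => // _ [_ [r ->] <-].
  rewrite setTI.
  rewrite (_ : _ @^-1` _ = \bigcup_k box
    [tuple (if j == i then r else - k%:R)%R | j < n] [tuple (k%:R)%R | j < n]).
    apply: bigcupT_measurable => k; apply: sub_sigma_algebra.
    by exists ([tuple (if j == i then r else - k%:R)%R | j < n], [tuple (k%:R)%R | j < n]).
  apply/seteqP; split => x /=; rewrite in_itv/= andbT.
    move=> rx; pose M := \big[Num.max/0%R]_(j < n) `|tnth x j|%R.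
    have xM j : (`|tnth x j| <= (Num.bound M)%:R)%R.
      have M0 : (0 <= M)%R by rewrite /M; elim/big_ind : _ => // a b a0 b0; rewrite le_max a0.
      rewrite (@le_trans _ _ M)//; first by rewrite /M (bigD1 j)//= le_max lexx.
      exact: ltW (archi_boundP M0).
    exists (Num.bound M) => //= j; have := xM j; rewrite ler_norml => /andP[h1 h2].
    by rewrite !tnth_mktuple h2 andbT; case: eqP => [->|].
  by move=> [k _ /(_ i)]; rewrite !tnth_mktuple eqxx => /andP[].
by move=> A mA; rewrite -[A]setTI; exact: mid.
Qed.

(** Half-spaces are Caratheodory measurable, hence so are Borel sets, and [lebesgue_p] restricts to
    a measure on them. It agrees with [tleb] on boxes, a generating family closed under
    intersection, and uniqueness of measures concludes. *)
Theorem lebesgue_p_tleb n (A : set (n.+1.-tuple R)) : measurable A ->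
  lebesgue_p A = tleb n.+1 A.
Proof.
pose mu : {outer_measure set (n.+1.-tuple R) -> \bar R} := @lebesgue_p R n.+1.
pose U := caratheodory_type mu.
have mid : measurable_fun setT (id : U -> n.+1.-tuple R).
  apply/measurable_fun_tnthP => i.
  apply: (measurability _ (RGenOInfty.measurableE R)) => // _ [_ [r ->] <-].
  rewrite setTI (_ : _ @^-1` _ = [set x | (r < tnth x i)%R]).
    exact: caratheodory_halfspace.
  by apply/seteqP; split => x /=; rewrite in_itv/= andbT.
pose m : {measure set (n.+1.-tuple R) -> \bar R} :=
  measure_function_pushforward__canonical__measure_function_Measure
    (mu : {measure set (caratheodory_type mu) -> \bar R}) mid.
have mE B : m B = lebesgue_p B by [].
move=> mA; rewrite -mE; apply/esym.
pose G := [set box ab.1 ab.2 | ab in [set: n.+1.-tuple R * n.+1.-tuple R]].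
pose g k : set (n.+1.-tuple R) := box [tuple (- k%:R)%R | j < n.+1] [tuple (k%:R)%R | j < n.+1].
have kk k (j : 'I_n.+1) : (tnth [tuple (- k%:R)%R | j < n.+1] j <=
    tnth [tuple (k%:R)%R | j < n.+1] j :> R)%R.
  by rewrite !tnth_mktuple ge0_cp// ler0n.
apply: (@measure_unique _ _ _ G g) => //.
- exact: measurable_tuple_boxes.
- move=> _ _ [[a b] _ <-] [[c d] _ <-].
  exists ([tuple Num.max (tnth a i) (tnth c i) | i < n.+1],
          [tuple Num.min (tnth b i) (tnth d i) | i < n.+1]) => //.
  apply/seteqP; split => x /=.
    move=> h; split => i; have := h i; rewrite !tnth_mktuple ge_max le_min.
      by move=> /andP[/andP[-> _] /andP[->]].
    by move=> /andP[/andP[_ ->] /andP[_ ->]].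
  move=> [h1 h2] i; rewrite !tnth_mktuple ge_max le_min.
  by move: (h1 i) (h2 i) => /andP[-> ->] /andP[-> ->].
- by move=> k; exists ([tuple (- k%:R)%R | j < n.+1], [tuple (k%:R)%R | j < n.+1]).
- rewrite -subTset => x _; pose M := \big[Num.max/0%R]_(j < n.+1) `|tnth x j|%R.
  exists (Num.bound M) => //= j; rewrite !tnth_mktuple -ler_norml.
  have M0 : (0 <= M)%R by rewrite /M; elim/big_ind : _ => // a b a0 b0; rewrite le_max a0.
  rewrite (@le_trans _ _ M)//; first by rewrite /M (bigD1 j)//= le_max lexx.
  exact: ltW (archi_boundP M0).
- move=> _ [[a b] _ <-] /=; rewrite mE.
  have [ab|] := pselect (forall i, (tnth a i <= tnth b i)%R).
    apply/eqP; rewrite eq_le tleb_le_lebesgue_p ?tleb_box//=; last exact: measurable_box.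
    rewrite lebesgue_pE.
    rewrite -[leRHS]boxm_box//.
    pose F k := if k is 0 then box a b else set0.
    have <- : \sum_(k <oo) boxm n.+1 (F k) = boxm n.+1 (box a b).
      rewrite nneseries_recl//; last by move=> *; exact: boxm_ge0.
      rewrite eseries_cond/= eseries0 ?adde0// => -[|]//= k _ _.
      exact: boxm0.
    apply: ereal_inf_lbound; exists F => //; split; last by move=> x abx; exists 0%N.
    by move=> [|k] /=; [exact: measurable_box|].
  move=> /existsNP[i /negP]; rewrite -ltNge => ba.
  rewrite (_ : box a b = set0) ?measure0 -?mE ?measure0//.
  apply/seteqP; split => x //= /(_ i) /andP[h1 h2].
  by have := le_trans h1 h2; rewrite leNgt ba.
- by move=> k; rewrite /g/= tleb_box ?ltry.
Qed.

Import HBNNSimple.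

(** The integral is a difference of suprema of integrals of simple functions, and those evaluate the
    set function on measurable sets only. *)
Lemma integral_lebesgue_p n (F : n.+1.-tuple R -> \bar R) :
  \int[@lebesgue_p R n.+1]_x F x = \int[tleb n.+1]_x F x.
Proof.
have sE (h : {nnsfun n.+1.-tuple R >-> R}) :
    sintegral (@lebesgue_p R n.+1) h = sintegral (tleb n.+1) h.
  by apply: eq_fsbigr => r _; congr (_ * _); exact: lebesgue_p_tleb.
rewrite /integral; congr (ereal_sup _ - ereal_sup _);
  by apply/seteqP; split => _ [h hF <-]; exists h => //; rewrite sE.
Qed.

End lebesgue_p_tleb.

(** * Gaussian densities *)

Section gaussian.
Set Implicit Arguments.
Unset Strict Implicit.
Context {R : realType}.
Implicit Types (n : nat) (s t : R).

Lemma normsq_ge0 n (x : n.-tuple R) : 0 <= normsq x.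
Proof. by apply: sumr_ge0 => i _; exact: sqr_ge0. Qed.

Lemma measurable_normsq n : measurable_fun setT (@normsq R n).
Proof.
apply: measurable_sum => i; apply: measurable_funX.
exact: measurable_tnth.
Qed.

Lemma normsq_tcons n (x : R) (v : n.-tuple R) :
  normsq (tcons (x, v)) = x ^+ 2 + normsq v.
Proof.
rewrite /normsq big_ord_recl/=; congr (_ + _).
by apply: eq_bigr => i _; rewrite /tcons/= tnthS.
Qed.

(** The mean is kept general for the completed square in [integral_bexp_lty]. *)
Lemma integral_gauss1 (m s : R) : 0 < s ->
  (\int[lebesgue_measure]_x (expR (- ((x - m) ^+ 2 / (2 * s))))%:E =
    (Num.sqrt (2 * pi * s))%:E)%E.
Proof.
move=> s0; have ss0 : Num.sqrt s != 0 by rewrite gt_eqF// sqrtr_gt0.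
have K0 : 0 < Num.sqrt (2 * pi * s) by rewrite sqrtr_gt0 !mulr_gt0// pi_gt0.
have := integral_normal_pdf m (Num.sqrt s).
under eq_integral => x _.
  rewrite (_ : normal_pdf _ _ _ =
    (Num.sqrt (2 * pi * s))^-1 * expR (- ((x - m) ^+ 2 / (2 * s)))); last first.
    rewrite normal_pdfE// /normal_peak /normal_fun sqr_sqrtr ?(ltW s0)//.
    congr (_^-1 * expR _); last by rewrite mulNr mulr_natl.
    by congr Num.sqrt; rewrite -mulr_natr; ring.
  rewrite EFinM; over.
rewrite /= ge0_integralZl_EFin//=; last first.
  apply/measurable_EFinP; apply: measurableT_comp => //.
  apply: measurableT_comp => //; apply: measurable_funM => //.
  by apply: measurable_funX; exact: measurable_funB.
move=> /(congr1 (mule (Num.sqrt (2 * pi * s))%:E)).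
by rewrite muleA -EFinM divff ?gt_eqF// mul1e mule1.
Qed.

Definition gaussfun n s (x : n.-tuple R) : R := expR (- (normsq x / (2 * s))).

Lemma gaussfun_gt0 n s (x : n.-tuple R) : 0 < gaussfun s x.
Proof. exact: expR_gt0. Qed.

Lemma measurable_gaussfun n s : measurable_fun setT (@gaussfun n s).
Proof.
apply: measurableT_comp => //; apply: measurableT_comp => //.
by apply: measurable_funM => //; exact: measurable_normsq.
Qed.

Lemma integral_gaussfun n s : 0 < s ->
  (\int[tleb n]_x (gaussfun s x)%:E = (Num.sqrt (2 * pi * s) ^+ n)%:E)%E.
Proof.
move=> s0; elim: n => [|n IH].
  rewrite integral_tleb0//=; last by apply/measurable_EFinP; exact: measurable_gaussfun.
  by rewrite /gaussfun /normsq big_ord0 mul0r oppr0 expR0 expr0.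
rewrite integral_tlebS//=; last 2 first.
- by apply/measurable_EFinP; exact: measurable_gaussfun.
- by move=> x; rewrite lee_fin ltW// gaussfun_gt0.
have E x : (\int[tleb n]_v (gaussfun s (tcons (x, v)))%:E =
    (Num.sqrt (2 * pi * s) ^+ n)%:E * (expR (- ((x - 0) ^+ 2 / (2 * s))))%:E)%E.
  have mg : measurable_fun setT (fun v : n.-tuple R => (gaussfun s v)%:E).
    by apply/measurable_EFinP; exact: measurable_gaussfun.
  have g0 (v : n.-tuple R) : (0 <= (gaussfun s v)%:E)%E.
    by rewrite lee_fin ltW// gaussfun_gt0.
  rewrite muleC -IH -ge0_integralZl_EFin ?expR_ge0//.
  apply: eq_integral => v _; rewrite -EFinM /gaussfun -expRD normsq_tcons subr0.
  by rewrite mulrDl opprD.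
under eq_integral do rewrite E.
rewrite ge0_integralZl_EFin ?exprn_ge0 ?sqrtr_ge0//=; last first.
  apply/measurable_EFinP; apply: measurableT_comp => //.
  apply: measurableT_comp => //; apply: measurable_funM => //.
  by apply: measurable_funX; exact: measurable_funB.
by rewrite integral_gauss1// -EFinM -exprSr.
Qed.

Lemma integrable_gaussfun n s : 0 < s ->
  (tleb n).-integrable setT (EFin \o @gaussfun n s).
Proof.
move=> s0; apply/integrableP; split.
  by apply/measurable_EFinP; exact: measurable_gaussfun.
rewrite (eq_integral (fun x => (gaussfun s x)%:E)) ?integral_gaussfun ?ltry//.
by move=> x _ /=; rewrite ger0_norm// ltW// gaussfun_gt0.
Qed.

(** By y <= exp y with y = |x|^2 / (4 s), half of the exponent absorbs the quadratic factor; a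
    Gaussian of variance 2 s remains as dominating function. *)
Lemma integrable_normsq_gaussfun n s : 0 < s ->
  (tleb n).-integrable setT (EFin \o (fun x => normsq x * @gaussfun n s x)).
Proof.
move=> s0.
apply: (@le_integrable _ _ _ (tleb n) setT measurableT _
  (fun x => (4 * s)%:E * (EFin \o @gaussfun n (2 * s)) x)%E).
- apply/measurable_EFinP; apply: measurable_funM; first exact: measurable_normsq.
  exact: measurable_gaussfun.
- move=> x _ /=; have q0 := normsq_ge0 x.
  rewrite lee_fin !normrM normr_nat (gtr0_norm s0) (ger0_norm q0).
  rewrite !(gtr0_norm (gaussfun_gt0 _ _)) /gaussfun.
  have -> : normsq x / (2 * s) = normsq x / (2 * (2 * s)) + normsq x / (2 * (2 * s)).
    by field; rewrite gt_eqF.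
  have yE : normsq x = 4 * s * (normsq x / (2 * (2 * s))).
    by field; rewrite gt_eqF.
  set y := normsq x / (2 * (2 * s)) in yE *.
  rewrite opprD expRD (mulrA (normsq x)) ler_pM2r ?expR_gt0// expRN ler_pdivrMr ?expR_gt0//.
  rewrite yE.
  rewrite ler_pM2l ?mulr_gt0//; apply: le_trans (expR_ge1Dx _).
  by rewrite lerDr.
- by apply: integrableZl => //; apply: integrable_gaussfun; rewrite mulr_gt0.
Qed.

Definition gaussd n s (x : n.-tuple R) : R :=
  (Num.sqrt (2 * pi * s) ^+ n)^-1 * gaussfun s x.

Lemma gaussd_cst_gt0 n s : 0 < s -> 0 < Num.sqrt (2 * pi * s) ^+ n.
Proof. by move=> s0; rewrite exprn_gt0// sqrtr_gt0 !mulr_gt0// pi_gt0. Qed.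

Lemma gaussd_gt0 n s (x : n.-tuple R) : 0 < s -> 0 < gaussd s x.
Proof. by move=> s0; rewrite mulr_gt0 ?invr_gt0 ?gaussd_cst_gt0 ?gaussfun_gt0. Qed.

Lemma measurable_gaussd n s : measurable_fun setT (@gaussd n s).
Proof. by apply: measurable_funM => //; exact: measurable_gaussfun. Qed.

Lemma ln_gaussd n s (x : n.-tuple R) : 0 < s ->
  ln (gaussd s x) = - (n%:R / 2 * ln (2 * pi * s) + normsq x / (2 * s)).
Proof.
move=> s0; have t0 : 0 < 2 * pi * s by rewrite !mulr_gt0// pi_gt0.
have c0 := gaussd_cst_gt0 n s0.
have -> : ln (gaussd s x) =
    ln (Num.sqrt (2 * pi * s) ^+ n)^-1 + ln (gaussfun s x).
  by rewrite -lnM ?posrE ?invr_gt0// gaussfun_gt0.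
rewrite lnV ?posrE// expRK lnXn ?sqrtr_gt0//.
rewrite -powR12_sqrt ?(ltW t0)// ln_powR opprD; congr (- _ + _).
by rewrite -[LHS]mulr_natl mulrA.
Qed.

Lemma integrable_gaussd n s : 0 < s ->
  (tleb n).-integrable setT (EFin \o @gaussd n s).
Proof.
move=> s0; have := integrableZl measurableT (Num.sqrt (2 * pi * s) ^+ n)^-1
  (@integrable_gaussfun n s s0).
by apply: eq_integrable => // x _ /=; rewrite -EFinM.
Qed.

Lemma integral_gaussd n s : 0 < s -> (\int[tleb n]_x (gaussd s x)%:E = 1)%E.
Proof.
move=> s0; under eq_integral do rewrite /gaussd EFinM.
rewrite integralZl//; last exact: integrable_gaussfun.
by rewrite integral_gaussfun// -EFinM mulVf// gt_eqF// gaussd_cst_gt0.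
Qed.

Lemma integrable_normsq_gaussd n s : 0 < s ->
  (tleb n).-integrable setT (EFin \o (fun x => normsq x * @gaussd n s x)).
Proof.
move=> s0; have := integrableZl measurableT (Num.sqrt (2 * pi * s) ^+ n)^-1
  (@integrable_normsq_gaussfun n s s0).
apply: eq_integrable => // x _ /=.
by rewrite -EFinM /gaussd mulrCA.
Qed.

Lemma ln_le_subr1 t : 0 < t -> ln t <= t - 1.
Proof. by move=> t0; have := expR_ge1Dx (ln t); rewrite lnK ?posrE// => h; lra. Qed.

(** Pointwise Gibbs inequality, from ln t <= t - 1 at t = b / a. For two densities of mass 1 the
    left side integrates to 0. *)
Lemma gibbs (a b : R) : 0 < a -> 0 < b -> a - b <= a * ln (a / b).
Proof.
move=> a0 b0; have ba : 0 < b / a by rewrite divr_gt0.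
have := ln_le_subr1 ba; rewrite -(ler_pM2l a0) mulrBr mulr1 mulrCA divff ?gt_eqF// mulr1.
have -> : ln (b / a) = - ln (a / b) by rewrite !ln_div ?posrE// opprB.
by rewrite mulrN; lra.
Qed.

(* Nonnegativity of the relative entropy of two centred Gaussians, as the
   variance of the second one varies, determines the second moment. *)
Lemma integral_normsq_gaussd n s : 0 < s ->
  (\int[tleb n.+1]_x (normsq x * gaussd s x)%:E = (n.+1%:R * s)%:E)%E.
Proof.
move=> s0; set p := n.+1; have p0 : 0 < p%:R :> R by rewrite ltr0n.
have iN := @integrable_normsq_gaussd p s s0.
have JE := fineK (integrable_fin_num measurableT iN).
rewrite -[LHS]JE; set J := fine _ in JE *.
(* Relative entropy of variance s with respect to variance t; the unknown second moment J enters
   linearly. *)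
have KL t : 0 < t ->
    0 <= p%:R / 2 * (ln t - ln s) + (1 / (2 * t) - 1 / (2 * s)) * J.
  move=> t0; rewrite -lee_fin EFinD (EFinM _ J) JE.
  have -> : (p%:R / 2 * (ln t - ln s))%:E =
      (\int[tleb p]_x ((p%:R / 2 * (ln t - ln s))%:E * (gaussd s x)%:E))%E.
    by rewrite integralZl ?integral_gaussd ?mule1//; exact: integrable_gaussd.
  rewrite -integralZl// -integralD//; last 2 first.
  - by apply: integrableZl => //; exact: integrable_gaussd.
  - exact: integrableZl.
  have -> : (0:R)%:E = (\int[tleb p]_x ((gaussd s x)%:E - (gaussd t x)%:E))%E.
    rewrite integralB//; [|exact: integrable_gaussd..].
    by rewrite !integral_gaussd// subee.
  apply: le_integral => //=.
  - exact: (integrableB measurableT (integrable_gaussd p s0) (integrable_gaussd p t0)).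
  - exact: (integrableD measurableT
      (integrableZl measurableT _ (integrable_gaussd p s0)) (integrableZl measurableT _ iN)).
  move=> x _; rewrite -EFinB -!EFinM -EFinD lee_fin.
  apply: le_trans (gibbs (gaussd_gt0 x s0) (gaussd_gt0 x t0)) _.
  rewrite ln_div ?posrE ?gaussd_gt0// !ln_gaussd//.
  rewrite !(lnM (x := 2 * pi)) ?posrE ?mulr_gt0 ?pi_gt0//.
  by rewrite le_eqVlt; apply/orP; left; apply/eqP; field; rewrite !gt_eqF.
have J0 : 0 <= J.
  apply: fine_ge0; apply: integral_ge0 => x _ /=.
  by rewrite lee_fin mulr_ge0 ?normsq_ge0// ltW// gaussd_gt0.
congr EFin.
(* If J were 0, then t = s / 2 would give the negative value - (p / 2) ln 2. *)
have {}J0 : 0 < J.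
  rewrite lt_neqAle J0 andbT eq_sym; apply/eqP => J00.
  have := KL (s / 2); rewrite J00 mulr0 addr0 divr_gt0// => /(_ isT).
  rewrite pmulr_rge0 ?divr_gt0// ln_div ?posrE//.
  by have := @ln_gt0 R 2; rewrite ltr1n => /(_ isT); lra.
have ps0 : 0 < p%:R * s by rewrite mulr_gt0.
pose w := J / (p%:R * s); have w0 : 0 < w by rewrite divr_gt0.
(* t = J / p minimises the expression over t. With w = J / (p s) the inequality becomes ln w >= w -
   1, which forces w = 1. *)
have := KL (J / p%:R); rewrite divr_gt0// => /(_ isT).
have -> : J / p%:R = w * s by rewrite /w; field; rewrite !gt_eqF.
rewrite lnM ?posrE// addrK.
have -> : (1 / (2 * (w * s)) - 1 / (2 * s)) * J = p%:R / 2 * (1 - w).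
  by rewrite /w; field; rewrite !gt_eqF.
rewrite -mulrDr pmulr_rge0 ?divr_gt0// => h.
have w1 : w = 1.
  apply/eqP/negPn/negP => w1.
  have := @expR_gt1Dx R (ln w); rewrite ln_eq0// => /(_ w1); rewrite lnK ?posrE//.
  by lra.
by rewrite -[J](@divfK _ (p%:R * s)) ?gt_eqF// -/w w1 mul1r.
Qed.

End gaussian.

(** * Probability measures given by a density *)

Section density.
Set Implicit Arguments.
Unset Strict Implicit.
Context d (T : measurableType d) (R : realType).
Variables (mu : {sigma_finite_measure set T -> \bar R}) (phi : T -> R).
Hypotheses (mphi : measurable_fun setT phi) (phi0 : forall x, 0 <= phi x).
Hypothesis phi1 : (\int[mu]_x (phi x)%:E = 1)%E.
Local Open Scope ereal_scope.

(** The set function [A |-> \int_A phi] is absolutely continuous with respect to mu, and its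
    Radon-Nikodym derivative is phi almost everywhere; the change of variables formula then gives
    the integrals. *)
Lemma density_probability : exists Q : probability T R,
  forall g : T -> \bar R, measurable_fun setT g -> (forall x, 0 <= g x) ->
    \int[Q]_x g x = \int[mu]_x (g x * (phi x)%:E).
Proof.
have mE : measurable_fun setT (fun x => (phi x)%:E) by exact/measurable_EFinP.
have E0 x : 0 <= (phi x)%:E by rewrite lee_fin.
pose m A := \int[mu]_(x in A) (phi x)%:E.
have m0 : m set0 = 0 by rewrite /m integral_set0.
have mge0 A : 0 <= m A by exact: integral_ge0.
have msig : semi_sigma_additive m.
  move=> F mF tF mUF; rewrite /m ge0_integral_bigcup//=; last exact: measurable_funTS.
  by apply: is_cvg_ereal_nneg_natsum_cond => k _ _; exact: integral_ge0.
have mT : m setT = 1 by [].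
pose mm := isMeasure.Build _ _ _ m m0 mge0 msig.
pose Mm : {measure set T -> \bar R} := HB.pack m mm.
pose pm := Measure_isProbability.Build _ _ _ Mm mT.
pose Q : probability T R := HB.pack m mm pm.
exists Q => g mg g0.
have Qmu : Q `<< mu.
  apply/null_content_dominatesP => A mA A0.
  by rewrite /Q/= /m; apply: null_set_integral => //; exact: measurable_funTS.
rewrite -(Radon_Nikodym_SigmaFinite.change_of_variables Qmu)//.
have fge0 := Radon_Nikodym_SigmaFinite.f_ge0 Qmu.
have fint := Radon_Nikodym_SigmaFinite.f_integrable Qmu.
have mRN := measurable_int _ fint.
apply: ge0_ae_eq_integral => //.
- exact: emeasurable_funM.
- exact: emeasurable_funM.
- by move=> x _; exact: mule_ge0.
- by move=> x _; exact: mule_ge0.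
apply: ae_eqe_mul2l; apply: integral_ae_eq => // E _ mE'.
by rewrite -Radon_Nikodym_SigmaFinite.f_integral.
Qed.

End density.

(** * Additive noise channels *)

Section translations.
Set Implicit Arguments.
Unset Strict Implicit.
Context {R : realType} {n : nat}.
Implicit Types x y : n.-tuple R.
Local Notation T := (n.-tuple R).

Definition tadd y x : T := [tuple tnth y i + tnth x i | i < n].

Lemma tsubK y x : tadd (tsub y x) x = y.
Proof. by apply: eq_from_tnth => i; rewrite !tnth_mktuple subrK. Qed.

Lemma taddC y x : tadd y x = tadd x y.
Proof. by apply: eq_from_tnth => i; rewrite !tnth_mktuple addrC. Qed.

Lemma measurable_tadd : measurable_fun setT (fun yx : T * T => tadd yx.1 yx.2).
Proof.
apply/measurable_fun_tnthP => i.
rewrite (_ : _ \o _ = fun yx : T * T => tnth yx.1 i + tnth yx.2 i).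
  apply: measurable_funD.
    exact: (measurableT_comp (measurable_tnth i) measurable_fst).
  exact: (measurableT_comp (measurable_tnth i) measurable_snd).
by apply/funext => yx /=; rewrite tnth_mktuple.
Qed.

Lemma measurable_taddl x : measurable_fun setT (fun y => tadd y x).
Proof. exact: (measurableT_comp measurable_tadd (pair2_measurable x)). Qed.

(** Coordinatewise, the two sides differ by the square (e b - a)^2 / e. The parameter stays free so
    that the factor of |x|^2 can be brought close to 1. *)
Lemma normsq_tadd_le (e : R) y x : 0 < e ->
  normsq (tadd y x) <= (1 + e) * normsq x + (1 + e^-1) * normsq y.
Proof.
move=> e0; rewrite /normsq !mulr_sumr -big_split/=; apply: ler_sum => i _.
rewrite tnth_mktuple; set a := tnth y i; set b := tnth x i.
have -> : (1 + e) * b ^+ 2 + (1 + e^-1) * a ^+ 2 =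
    (a + b) ^+ 2 + e^-1 * (e * b - a) ^+ 2 by field; rewrite gt_eqF.
by rewrite lerDl mulr_ge0 ?invr_ge0 ?(ltW e0) ?sqr_ge0.
Qed.

Lemma normsq_tsub_le y x : normsq (tsub y x) <= 2 * normsq y + 2 * normsq x.
Proof.
rewrite /normsq !mulr_sumr -big_split/=; apply: ler_sum => i _.
rewrite tnth_mktuple; set a := tnth y i; set b := tnth x i.
by have := sqr_ge0 (a + b); rewrite !expr2; lra.
Qed.

Local Open Scope ereal_scope.

(** Positive and negative parts are translated separately, so the equality holds even for a function
    that is not integrable. *)
Lemma integral_tleb_translate (F : T -> \bar R) x : measurable_fun setT F ->
  \int[tleb n]_y F (tsub y x) = \int[tleb n]_y F y.
Proof.
move=> mF; rewrite integralE [RHS]integralE; congr (_ - _).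
  rewrite -[RHS](integral_tleb_shift n (F^\+) x)//; last exact: measurable_funepos.
  by apply: eq_integral => y _; rewrite !funeposE.
rewrite -[RHS](integral_tleb_shift n (F^\-) x)//; last exact: measurable_funeneg.
by apply: eq_integral => y _; rewrite !funenegE.
Qed.

Lemma integrable_tleb_translate (F : T -> \bar R) x :
  (tleb n).-integrable setT F ->
  (tleb n).-integrable setT (fun y => F (tsub y x)).
Proof.
move=> /integrableP[mF Foo]; apply/integrableP; split.
  exact: (measurableT_comp mF (measurable_tsubl _ x)).
rewrite (integral_tleb_translate (F := abse \o F))//.
exact: measurableT_comp.
Qed.

Lemma integral_tleb_tadd (F : T -> \bar R) x : measurable_fun setT F ->
  \int[tleb n]_y F (tadd y x) = \int[tleb n]_y F y.
Proof.
move=> mF; rewrite -[LHS](integral_tleb_translate x).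
  by apply: eq_integral => y _; rewrite tsubK.
exact: (measurableT_comp mF (measurable_taddl x)).
Qed.

End translations.

(** * Channels with noise density between a Gaussian-type lower bound and a constant *)

Section channel.
Set Implicit Arguments.
Unset Strict Implicit.
Context {R : realType} {n : nat}.
Local Notation p := n.+1.
Local Notation T := (n.+1.-tuple R).
Local Notation mu := (tleb n.+1).
Variables (f : T -> R) (M c kk C : R).
Hypotheses (mf : measurable_fun setT f) (f_gt0 : forall x, 0 < f x).
Hypotheses (f_le : forall x, f x <= M) (M1 : 1 <= M).
Hypothesis f_int : (\int[mu]_x (f x)%:E = 1)%E.
Hypothesis f_mom : (\int[mu]_x (f x * normsq x)%:E = c%:E)%E.
Hypotheses (k0_gt0 : 0 < kk) (C0 : 0 <= C).
Hypothesis f_ge : forall x, kk * expR (- (C * normsq x)) <= f x.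

Let M0 : 0 < M. Proof. exact: lt_le_trans M1. Qed.

Let f_ge0 x : 0 <= f x. Proof. exact: ltW. Qed.

Lemma integral_quad (a b : R) : 0 <= a -> 0 <= b ->
  (\int[mu]_x (f x * (a + b * normsq x))%:E = (a + b * c)%:E)%E.
Proof.
move=> a0 b0.
have m1 : measurable_fun setT (fun x : T => (f x)%:E) by exact/measurable_EFinP.
have m2 : measurable_fun setT (fun x : T => (f x * normsq x)%:E).
  by apply/measurable_EFinP/measurable_funM => //; exact: measurable_normsq.
have fn0 (x : T) : (0 <= (f x * normsq x)%:E)%E by rewrite lee_fin mulr_ge0 ?normsq_ge0.
transitivity (\int[mu]_x (a%:E * (f x)%:E + b%:E * (f x * normsq x)%:E))%E.
  apply: eq_integral => x _; rewrite -!EFinM -EFinD; congr EFin; ring.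
rewrite ge0_integralD//=.
- rewrite !ge0_integralZl_EFin//=; last by move=> x _; rewrite lee_fin.
  by rewrite f_int f_mom mule1.
- by move=> x _; rewrite mule_ge0// lee_fin.
- exact: measurable_funeM.
- by move=> x _; rewrite mule_ge0// lee_fin.
- exact: measurable_funeM.
Qed.

Lemma integrable_quad (a b : R) : 0 <= a -> 0 <= b ->
  mu.-integrable setT (fun x => (f x * (a + b * normsq x))%:E).
Proof.
move=> a0 b0; apply/integrableP; split.
  apply/measurable_EFinP/measurable_funM => //; apply: measurable_funD => //.
  by apply: measurable_funM => //; exact: measurable_normsq.
rewrite (eq_integral (fun x => (f x * (a + b * normsq x))%:E)) ?integral_quad ?ltry//.
by move=> x _ /=; rewrite ger0_norm// mulr_ge0// addr_ge0// mulr_ge0// normsq_ge0.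
Qed.

Lemma integrable_f : mu.-integrable setT (fun x => (f x)%:E).
Proof.
have := @integrable_quad 1 0 ler01 (lexx _).
by apply: eq_integrable => // x _; rewrite mul0r addr0 mulr1.
Qed.

Lemma c_ge0 : 0 <= c.
Proof.
rewrite -lee_fin -f_mom; apply: integral_ge0 => x _.
by rewrite lee_fin mulr_ge0 ?normsq_ge0.
Qed.

(** The two bounds on f give |ln f| <= ln M + |ln kk| + C |x|^2, and f has a finite second
    moment. *)
Lemma integrable_flnf : mu.-integrable setT (fun x => (f x * ln (f x))%:E).
Proof.
apply: (@le_integrable _ _ _ mu setT measurableT _
  (fun x => (f x * ((ln M + `|ln kk|) + C * normsq x))%:E)).
- apply/measurable_EFinP/measurable_funM => //.
  exact: measurableT_comp.
- move=> x _; rewrite lee_fin !normrM (ger0_norm (f_ge0 x)) ler_pM2l//.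
  have lM : 0 <= ln M by exact: ln_ge0.
  have q0 : 0 <= C * normsq x by rewrite mulr_ge0// normsq_ge0.
  have k0 := normr_ge0 (ln kk).
  rewrite (@ger0_norm _ (_ + _ + _)) ?addr_ge0// ler_norml; apply/andP; split.
    have : ln (kk * expR (- (C * normsq x))) <= ln (f x).
      by rewrite ler_ln ?posrE// mulr_gt0// expR_gt0.
    rewrite lnM ?posrE ?expR_gt0// expRK.
    by have := ler_norm (- ln kk); rewrite normrN; lra.
  have : ln (f x) <= ln M by rewrite ler_ln ?posrE.
  lra.
- by apply: integrable_quad => //; rewrite addr_ge0// ln_ge0.
Qed.

(** This is - h(N); [fine] loses nothing by [integrable_flnf]. *)
Definition flnf : R := fine (\int[mu]_x (f x * ln (f x))%:E)%E.

Lemma flnfE : (\int[mu]_x (f x * ln (f x))%:E = flnf%:E)%E.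
Proof. by rewrite fineK//; apply: integrable_fin_num => //; exact: integrable_flnf. Qed.

(** * Output law and mutual information for an input of bounded power *)

Section input.
Variables (PX : probability T R) (P : R).
Hypothesis PX_mom : (\int[PX]_x (normsq x)%:E <= P%:E)%E.

Let q := out_density f PX.

Let mfs : measurable_fun setT (fun xy : T * T => (f (tsub xy.2 xy.1))%:E).
Proof.
apply/measurable_EFinP; apply: (measurableT_comp mf).
apply: (measurableT_comp (measurable_tsub p) (g := fun xy : T * T => (xy.2, xy.1))).
exact: measurable_swap.
Qed.

Let mfsx x : measurable_fun setT (fun y : T => (f (tsub y x))%:E).
Proof. exact: (measurableT_comp mfs (pair1_measurable x)). Qed.

Let mfsy y : measurable_fun setT (fun x : T => (f (tsub y x))%:E).
Proof. exact: (measurableT_comp mfs (pair2_measurable y)). Qed.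

(** The integrand is at most M and PX has mass 1, so the integral is finite and the [fine] in
    [out_density] loses nothing. *)
Lemma out_densityE y : ((q y)%:E = \int[PX]_x (f (tsub y x))%:E)%E.
Proof.
rewrite /q/out_density fineK// ge0_fin_numE; last first.
  by apply: integral_ge0 => x _; rewrite lee_fin.
apply: (@le_lt_trans _ _ (\int[PX]_x (cst M%:E) x)%E).
  apply: ge0_le_integral => //=.
  - by move=> x _; rewrite lee_fin.
  - by move=> x _; rewrite lee_fin.
by rewrite integral_cst//= probability_setT mule1 ltry.
Qed.

Lemma out_density_le y : q y <= M.
Proof.
rewrite -lee_fin out_densityE.
apply: (@le_trans _ _ (\int[PX]_x (cst M%:E) x)%E).
  apply: ge0_le_integral => //=.
  - by move=> x _; rewrite lee_fin.
  - by move=> x _; rewrite lee_fin.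
by rewrite integral_cst//= probability_setT mule1.
Qed.

Lemma measurable_out_density : measurable_fun setT q.
Proof.
apply/measurable_EFinP.
rewrite (_ : _ \o _ = fubini_G PX (fun xy : T * T => (f (tsub xy.2 xy.1))%:E)).
  apply: measurable_fun_fubini_tonelli_G => //.
  by move=> x; rewrite lee_fin.
by apply/funext => y; rewrite /= out_densityE.
Qed.

(* Jensen's inequality for [expR (- a * _)], through the tangent line at [P]. *)
Lemma integral_expR_normsq (a : R) : 0 <= a ->
  ((expR (- (a * P)))%:E <= \int[PX]_x (expR (- (a * normsq x)))%:E)%E.
Proof.
move=> a0; set I := (X in (_ <= X)%E).
have mr : measurable_fun setT (fun x : T => (normsq x)%:E).
  by apply/measurable_EFinP; exact: measurable_normsq.
have P0 : 0 <= P.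
  rewrite -lee_fin (le_trans _ PX_mom)//; apply: integral_ge0 => x _.
  by rewrite lee_fin normsq_ge0.
set e := expR (- (a * P)); have e0 : 0 < e by exact: expR_gt0.
have : ((e * (1 + a * P))%:E <= I + (a * e * P)%:E)%E.
  apply: (@le_trans _ _ (I + (a * e)%:E * \int[PX]_x (normsq x)%:E)%E); last first.
    by rewrite leeD2l// (EFinM _ P) lee_wpmul2l// lee_fin mulr_ge0// ltW.
  rewrite -ge0_integralZl_EFin ?mulr_ge0 ?(ltW e0)//; last first.
    by move=> x _; rewrite lee_fin normsq_ge0.
  have mI : measurable_fun setT (fun x : T => (expR (- (a * normsq x)))%:E).
    apply/measurable_EFinP; apply: measurableT_comp => //; apply: measurableT_comp => //.
    by apply: measurable_funM => //; exact: measurable_normsq.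
  rewrite /I -ge0_integralD//=; last 2 first.
  - by move=> x _; rewrite mule_ge0 ?lee_fin ?normsq_ge0 ?mulr_ge0 ?(ltW e0).
  - exact: measurable_funeM.
  apply: (@le_trans _ _ (\int[PX]_x (cst (e * (1 + a * P))%:E) x)%E).
    by rewrite integral_cst//= probability_setT mule1.
  apply: ge0_le_integral => //=.
  - by move=> x _; rewrite lee_fin mulr_ge0 ?(ltW e0)// addr_ge0// mulr_ge0.
  - by apply: emeasurable_funD => //; exact: measurable_funeM.
  - move=> x _; rewrite -EFinM -EFinD lee_fin.
    have -> : - (a * normsq x) = - (a * P) + a * (P - normsq x) by ring.
    rewrite expRD -/e; set E := expR (a * _).
    have : e * (1 + a * (P - normsq x)) <= e * E by rewrite ler_pM2l// expR_ge1Dx.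
    have -> : e * (1 + a * (P - normsq x)) = e * (1 + a * P) - a * e * normsq x by ring.
    by lra.
have -> : (e * (1 + a * P))%:E = (e%:E + (a * e * P)%:E)%E.
  by rewrite -EFinD; congr EFin; ring.
by rewrite leeD2rE.
Qed.

(** Since |y - x|^2 <= 2 |y|^2 + 2 |x|^2, the lower bound on f factors into a part in y and a part
    in x; the power constraint bounds the mean of the latter through [integral_expR_normsq] with a =
    2 C. *)
Lemma out_density_ge y :
  kk * expR (- (2 * C * P)) * expR (- (2 * C * normsq y)) <= q y.
Proof.
rewrite -lee_fin out_densityE.
have mI : measurable_fun setT (fun x : T => (expR (- (2 * C * normsq x)))%:E).
  apply/measurable_EFinP; apply: measurableT_comp => //; apply: measurableT_comp => //.
  by apply: measurable_funM => //; exact: measurable_normsq.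
have k0 : 0 <= kk * expR (- (2 * C * normsq y)) by rewrite mulr_ge0 ?(ltW k0_gt0) ?expR_ge0.
apply: (@le_trans _ _ ((kk * expR (- (2 * C * normsq y)))%:E *
    \int[PX]_x (expR (- (2 * C * normsq x)))%:E)%E).
  rewrite mulrAC (EFinM _ (expR (- (2 * C * P)))) lee_wpmul2l ?lee_fin//.
  by apply: integral_expR_normsq; rewrite mulr_ge0.
rewrite -ge0_integralZl_EFin//=.
apply: ge0_le_integral => //=.
- by move=> x _; rewrite mule_ge0 ?lee_fin ?expR_ge0.
- exact: measurable_funeM.
move=> x _; rewrite -EFinM lee_fin; apply: le_trans (f_ge _).
rewrite -(mulrA kk) (ler_pM2l k0_gt0) -expRD ler_expR -opprD lerN2.
apply: le_trans (_ : C * (2 * normsq y + 2 * normsq x) <= _); last by lra.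
by rewrite ler_wpM2l// normsq_tsub_le.
Qed.

Lemma out_density_gt0 y : 0 < q y.
Proof. by apply: lt_le_trans (out_density_ge y); rewrite !mulr_gt0 ?expR_gt0. Qed.

(** The expectation of G at the output, conditioned on the input on the left; Tonelli exchanges the
    two integrals. *)
Lemma integral_output (G : T -> \bar R) :
  measurable_fun setT G -> (forall y, 0 <= G y)%E ->
  (\int[PX]_x \int[mu]_y ((f (tsub y x))%:E * G y) =
   \int[mu]_y ((q y)%:E * G y))%E.
Proof.
move=> mG G0.
have mFG : measurable_fun setT (fun xy : T * T => (f (tsub xy.2 xy.1))%:E * G xy.2)%E.
  apply: emeasurable_funM => //.
  exact: (measurableT_comp mG measurable_snd).
rewrite (fubini_tonelli (m2 := mu)
  (fun xy : T * T => (f (tsub xy.2 xy.1))%:E * G xy.2)%E)//=; last first.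
  by move=> xy; rewrite mule_ge0 ?lee_fin.
apply: eq_integral => y _; rewrite out_densityE.
by rewrite ge0_integralZr//= => x _; rewrite lee_fin.
Qed.

Lemma integral_shift_output (G : T -> \bar R) x : measurable_fun setT G ->
  (\int[mu]_y ((f (tsub y x))%:E * G y) =
   \int[mu]_v ((f v)%:E * G (tadd v x)))%E.
Proof.
move=> mG; rewrite -[RHS](integral_tleb_translate x).
  by apply: eq_integral => y _; rewrite tsubK.
apply: emeasurable_funM; first exact/measurable_EFinP.
exact: (measurableT_comp mG (measurable_taddl x)).
Qed.

(** The quantity - ln q raised by ln M to make it nonnegative, so that Tonelli and monotonicity
    apply to it directly. *)
Definition neglog_out y : R := ln (M / q y).

Lemma neglog_out_ge0 y : 0 <= neglog_out y.
Proof.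
apply: ln_ge0; rewrite ler_pdivlMr ?out_density_gt0// mul1r.
exact: out_density_le.
Qed.

Lemma neglog_outE y : neglog_out y = ln M - ln (q y).
Proof. by rewrite /neglog_out ln_div ?posrE// out_density_gt0. Qed.

Lemma measurable_neglog_out : measurable_fun setT (fun y : T => (neglog_out y)%:E).
Proof.
apply/measurable_EFinP; rewrite (_ : neglog_out = fun y => ln M - ln (q y)).
  by apply: measurable_funB => //; apply: measurableT_comp => //; exact: measurable_out_density.
by apply/funext => y; rewrite neglog_outE.
Qed.

Let A1 := ln M + `|ln kk| + 2 * C * P.

Let P_ge0 : 0 <= P.
Proof.
rewrite -lee_fin (le_trans _ PX_mom)//; apply: integral_ge0 => x _.
by rewrite lee_fin normsq_ge0.
Qed.

Let A1_ge0 : 0 <= A1.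
Proof. by rewrite /A1 !addr_ge0 ?ln_ge0// !mulr_ge0. Qed.

Lemma neglog_out_le y : neglog_out y <= A1 + 2 * C * normsq y.
Proof.
rewrite neglog_outE.
have k0 : 0 < kk * expR (- (2 * C * P)) by rewrite mulr_gt0 ?expR_gt0.
have : ln (kk * expR (- (2 * C * P)) * expR (- (2 * C * normsq y))) <= ln (q y).
  by rewrite ler_ln ?posrE ?out_density_gt0// ?mulr_gt0 ?expR_gt0// out_density_ge.
rewrite (lnM (x := kk * _)) ?posrE ?expR_gt0// (lnM (x := kk)) ?posrE ?expR_gt0//.
rewrite !expRK /A1; have := ler_norm (- ln kk); rewrite normrN; lra.
Qed.

Let L x := (\int[mu]_y ((f (tsub y x))%:E * (neglog_out y)%:E))%E.

Let L_ge0 x : (0 <= L x)%E.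
Proof. by apply: integral_ge0 => y _; rewrite mule_ge0 ?lee_fin ?neglog_out_ge0. Qed.

Let L_le x : (L x <= ((A1 + 4 * C * c) + 4 * C * normsq x)%:E)%E.
Proof.
have x0 := normsq_ge0 x.
rewrite /L (integral_shift_output x measurable_neglog_out).
have -> : A1 + 4 * C * c + 4 * C * normsq x =
    (A1 + 4 * C * normsq x) + 4 * C * c by ring.
have b0 : 0 <= 4 * C by rewrite mulr_ge0.
have a0 : 0 <= A1 + 4 * C * normsq x by rewrite addr_ge0 ?(mulr_ge0 b0).
rewrite -integral_quad//.
apply: ge0_le_integral => //=.
- by move=> v _; rewrite mule_ge0 ?lee_fin ?neglog_out_ge0.
- apply: emeasurable_funM; first exact/measurable_EFinP.
  exact: (measurableT_comp measurable_neglog_out (measurable_taddl x)).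
- apply/measurable_EFinP/measurable_funM => //; apply: measurable_funD => //.
  by apply: measurable_funM => //; exact: measurable_normsq.
- move=> v _; rewrite -EFinM lee_fin ler_pM2l//.
  apply: le_trans (neglog_out_le _) _.
  (* Only finiteness is at stake here, so e = 1 is enough; it turns 2 C into 4 C. *)
  have := normsq_tadd_le v x ltr01; rewrite invr1 => h.
  have : 2 * C * normsq (tadd v x) <= 2 * C * ((1 + 1) * normsq x + (1 + 1) * normsq v).
    by rewrite ler_wpM2l// mulr_ge0.
  by lra.
Qed.

Lemma integral_input_quad (a b : R) : 0 <= a -> 0 <= b ->
  (\int[PX]_x (a + b * normsq x)%:E <= (a + b * P)%:E)%E.
Proof.
move=> a0 b0.
have mr : measurable_fun setT (fun x : T => (normsq x)%:E).
  by apply/measurable_EFinP; exact: measurable_normsq.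
under eq_integral do rewrite EFinD (EFinM b).
rewrite ge0_integralD//=; last 2 first.
- by move=> x _; rewrite mule_ge0 ?lee_fin ?normsq_ge0.
- exact: measurable_funeM.
rewrite integral_cst//= probability_setT mule1 EFinD leeD2l// ge0_integralZl_EFin//.
  by rewrite EFinM lee_wpmul2l ?lee_fin.
by move=> x _; rewrite lee_fin normsq_ge0.
Qed.

Lemma measurable_mean_neglog_out : measurable_fun setT L.
Proof.
apply: (@measurable_fun_fubini_tonelli_F _ _ _ _ _ mu
  (fun xy : T * T => (f (tsub xy.2 xy.1))%:E * (neglog_out xy.2)%:E)%E).
  apply: emeasurable_funM => //.
  exact: (measurableT_comp measurable_neglog_out measurable_snd).
by move=> xy; rewrite mule_ge0 ?lee_fin ?neglog_out_ge0.
Qed.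

Let integrable_L : PX.-integrable setT L.
Proof.
apply/integrableP; split; first exact: measurable_mean_neglog_out.
rewrite (eq_integral L); last by move=> x _; rewrite gee0_abs.
apply: (@le_lt_trans _ _ (\int[PX]_x ((A1 + 4 * C * c) + 4 * C * normsq x)%:E)%E).
  apply: ge0_le_integral => //=.
    exact: measurable_mean_neglog_out.
  by apply/measurable_EFinP/measurable_funD => //; apply: measurable_funM => //;
    exact: measurable_normsq.
apply: (@le_lt_trans _ _ _ _ _ (integral_input_quad _ _)); last exact: ltry.
  by rewrite addr_ge0 ?mulr_ge0 ?c_ge0.
by rewrite mulr_ge0.
Qed.

Let integrable_flq x :
  mu.-integrable setT (fun y => (f (tsub y x))%:E * (neglog_out y)%:E)%E.
Proof.
apply/integrableP; split.
  by apply: emeasurable_funM => //; exact: measurable_neglog_out.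
rewrite (eq_integral (fun y => (f (tsub y x))%:E * (neglog_out y)%:E)%E); last first.
  by move=> y _; rewrite gee0_abs// mule_ge0 ?lee_fin ?neglog_out_ge0.
exact: le_lt_trans (L_le x) (ltry _).
Qed.

(** For each x, the part f(y - x) ln f(y - x) integrates to [flnf] by translation invariance. As
    [flnf] is finite it can be split off, and - ln M compensates the shift in [neglog_out]. *)
Lemma mutual_info_additiveE :
  mutual_info_additive f PX =
  ((flnf - ln M)%:E + \int[mu]_y ((q y)%:E * (neglog_out y)%:E))%E.
Proof.
rewrite /mutual_info_additive.
under eq_integral do rewrite integral_lebesgue_p -/q.
have K x : (\int[mu]_y (f (tsub y x) * ln (f (tsub y x) / q y))%:E =
    (flnf - ln M)%:E + L x)%E.
  have i1 := integrable_tleb_translate x integrable_flnf.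
  have i2 := integrable_tleb_translate x integrable_f.
  have i12 := integrableB measurableT i1 (integrableZl measurableT (ln M) i2).
  rewrite EFinB -flnfE -[X in (_ - X)%E]mule1 -f_int -integralZl//; last first.
    exact: integrable_f.
  rewrite -integralB//; [|exact: integrable_flnf|]; last first.
    by apply: integrableZl => //; exact: integrable_f.
  have mB : measurable_fun setT
      ((fun v : T => (f v * ln (f v))%:E) \- (fun v => (ln M)%:E * (f v)%:E))%E.
    apply: emeasurable_funB; first exact: measurable_int integrable_flnf.
    by apply: measurable_funeM; exact/measurable_EFinP.
  rewrite -(integral_tleb_translate x mB) /L -integralD//.
  apply: eq_integral => y _ /=.
  rewrite neglog_outE ln_div ?posrE ?out_density_gt0// -!EFinM -EFinB -EFinD.
  by congr EFin; ring.
under eq_integral do rewrite K.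
rewrite integralD//; last exact: finite_measure_integrable_cst.
rewrite integral_cst//= probability_setT mule1; congr (_ + _)%E.
by rewrite /L integral_output//;
  [exact: measurable_neglog_out|move=> y; rewrite lee_fin neglog_out_ge0].
Qed.

Lemma integral_out_density : (\int[mu]_y (q y)%:E = 1)%E.
Proof.
have := @integral_output (cst 1%E) (measurable_cst _) (fun=> lee01).
under [RHS]eq_integral do rewrite mule1.
move=> <-; under eq_integral.
  move=> x _; under eq_integral do rewrite mule1.
  rewrite (integral_tleb_translate x (F := fun v => (f v)%:E)) ?f_int; last exact/measurable_EFinP.
  over.
by rewrite integral_cst//= mul1e probability_setT.
Qed.

Lemma integral_normsq_output (e : R) : 0 < e ->
  (\int[mu]_y ((q y)%:E * (normsq y)%:E) <=
   ((1 + e) * P + (1 + e^-1) * c)%:E)%E.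
Proof.
move=> e0.
have e1 : 0 <= 1 + e^-1 by rewrite addr_ge0// invr_ge0 ltW.
have e2 : 0 <= 1 + e by rewrite addr_ge0// ltW.
have mr : measurable_fun setT (fun x : T => (normsq x)%:E).
  by apply/measurable_EFinP; exact: measurable_normsq.
rewrite -integral_output//; last by move=> y; rewrite lee_fin normsq_ge0.
rewrite addrC; apply: le_trans (integral_input_quad _ e2); last by rewrite mulr_ge0 ?c_ge0.
apply: ge0_le_integral => //=.
- by move=> x _; apply: integral_ge0 => y _; rewrite mule_ge0 ?lee_fin ?normsq_ge0.
- apply: (@measurable_fun_fubini_tonelli_F _ _ _ _ _ mu
    (fun xy : T * T => (f (tsub xy.2 xy.1))%:E * (normsq xy.2)%:E)%E).
    apply: emeasurable_funM => //.
    exact: (measurableT_comp mr measurable_snd).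
  by move=> xy; rewrite mule_ge0 ?lee_fin ?normsq_ge0.
- by apply/measurable_EFinP/measurable_funD => //; apply: measurable_funM => //;
    exact: measurable_normsq.
move=> x _; rewrite (integral_shift_output x mr) (addrC (_ * c)).
rewrite -integral_quad ?mulr_ge0 ?normsq_ge0//.
apply: ge0_le_integral => //=.
- by move=> v _; rewrite mule_ge0 ?lee_fin ?normsq_ge0.
- apply: emeasurable_funM; first exact/measurable_EFinP.
  exact: (measurableT_comp mr (measurable_taddl x)).
- apply/measurable_EFinP/measurable_funM => //; apply: measurable_funD => //.
  by apply: measurable_funM => //; exact: measurable_normsq.
- by move=> v _; rewrite -EFinM lee_fin ler_pM2l// normsq_tadd_le.
Qed.

(* Gibbs' inequality against the Gaussian density of variance [s]. *)
Lemma integral_neglog_out_le (s B : R) : 0 < s -> 1 <= 2 * pi * s ->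
  (\int[mu]_y ((q y)%:E * (normsq y)%:E) <= B%:E)%E ->
  (\int[mu]_y ((q y)%:E * (neglog_out y)%:E) <=
   (ln M + p%:R / 2 * ln (2 * pi * s) + B / (2 * s))%:E)%E.
Proof.
move=> s0 s1 qB; set A := ln M + _.
have A0 : 0 <= A by rewrite addr_ge0 ?ln_ge0// mulr_ge0// ln_ge0.
have i2s : 0 <= (2 * s)^-1 by rewrite invr_ge0 mulr_ge0// ltW.
have q0 y : 0 <= q y by rewrite ltW// out_density_gt0.
have mq : measurable_fun setT (fun y : T => (q y)%:E).
  by apply/measurable_EFinP; exact: measurable_out_density.
have mr : measurable_fun setT (fun x : T => (normsq x)%:E).
  by apply/measurable_EFinP; exact: measurable_normsq.
have mlq := measurable_neglog_out.
have mg : measurable_fun setT (fun y : T => (gaussd s y)%:E).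
  by apply/measurable_EFinP; exact: measurable_gaussd.
have g0 (y : T) : 0 <= gaussd s y by rewrite ltW// gaussd_gt0.
have r0 := @normsq_ge0 R p.
have l0 := neglog_out_ge0.
have qE0 y : ((0 : \bar R) <= (q y)%:E)%E by rewrite lee_fin.
have ql0 y : ((0 : \bar R) <= (q y)%:E * (neglog_out y)%:E)%E by rewrite mule_ge0 ?lee_fin.
have mql : measurable_fun setT (fun y => (q y)%:E * (neglog_out y)%:E)%E.
  exact: emeasurable_funM.
(* Adding 1, as the mass of q on the left and of the Gaussian on the right, rids Gibbs' inequality
   of its subtractions: both sides become integrals of nonnegative functions. *)
rewrite -(@leeD2rE _ 1%E)// -{1}integral_out_density -ge0_integralD//=.
apply: (@le_trans _ _ (\int[mu]_y (A%:E * (q y)%:E +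
    ((2 * s)^-1%:E * ((q y)%:E * (normsq y)%:E) + (gaussd s y)%:E)))%E).
  apply: ge0_le_integral => //=.
  - by move=> y _; rewrite adde_ge0 ?mule_ge0 ?lee_fin.
  - by apply: emeasurable_funD => //; exact: emeasurable_funM.
  - apply: emeasurable_funD; first exact: measurable_funeM.
    by apply: emeasurable_funD => //; apply: measurable_funeM; exact: emeasurable_funM.
  move=> y _; rewrite -!EFinM -!EFinD lee_fin.
  have qy := out_density_gt0 y.
  have := gibbs qy (gaussd_gt0 y s0).
  rewrite ln_div ?posrE ?gaussd_gt0// ln_gaussd// neglog_outE /A => h.
  have -> : (ln M + p%:R / 2 * ln (2 * pi * s)) * q y + ((2 * s)^-1 * (q y * normsq y) + gaussd s y)
    = q y * ln M + gaussd s y - q y * (- (p%:R / 2 * ln (2 * pi * s) + normsq y / (2 * s))) by ring.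
  by move: h; rewrite !mulrBr; lra.
have gE0 (y : T) : ((0 : \bar R) <= (gaussd s y)%:E)%E by rewrite lee_fin.
have qr0 y : ((0 : \bar R) <= (q y)%:E * (normsq y)%:E)%E by rewrite mule_ge0 ?lee_fin.
have mqr : measurable_fun setT (fun y => (q y)%:E * (normsq y)%:E)%E.
  exact: emeasurable_funM.
have t1 y : ((0 : \bar R) <= A%:E * (q y)%:E)%E by rewrite mule_ge0 ?lee_fin.
have m1 : measurable_fun setT (fun y => A%:E * (q y)%:E)%E by exact: measurable_funeM.
have t2 y : ((0 : \bar R) <= (2 * s)^-1%:E * ((q y)%:E * (normsq y)%:E))%E.
  by apply: mule_ge0 => //; rewrite lee_fin.
have m2 : measurable_fun setT
    (fun y => (2 * s)^-1%:E * ((q y)%:E * (normsq y)%:E))%E.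
  exact: measurable_funeM.
have t3 y : ((0 : \bar R) <=
    (2 * s)^-1%:E * ((q y)%:E * (normsq y)%:E) + (gaussd s y)%:E)%E.
  exact: adde_ge0.
have m3 : measurable_fun setT
    (fun y => (2 * s)^-1%:E * ((q y)%:E * (normsq y)%:E) + (gaussd s y)%:E)%E.
  exact: emeasurable_funD.
have AE : (\int[mu]_y (A%:E * (q y)%:E) = A%:E)%E.
  by rewrite ge0_integralZl_EFin// integral_out_density mule1.
rewrite ge0_integralD// ge0_integralD// AE ge0_integralZl_EFin//.
rewrite integral_gaussd// addeA leeD2r// (EFinD A) leeD2l//.
by rewrite (mulrC B) (EFinM _ B) lee_wpmul2l ?lee_fin.
Qed.

Theorem mutual_info_le (s e : R) : 0 < s -> 1 <= 2 * pi * s -> 0 < e ->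
  (mutual_info_additive f PX <= (flnf + p%:R / 2 * ln (2 * pi * s) +
     ((1 + e) * P + (1 + e^-1) * c) / (2 * s))%:E)%E.
Proof.
move=> s0 s1 e0; rewrite mutual_info_additiveE.
apply: le_trans (_ : (flnf - ln M)%:E + (ln M + p%:R / 2 * ln (2 * pi * s) +
    ((1 + e) * P + (1 + e^-1) * c) / (2 * s))%:E <= _)%E.
  by rewrite leeD2l// integral_neglog_out_le// integral_normsq_output.
rewrite -EFinD lee_fin le_eqVlt; apply/orP; left; apply/eqP; ring.
Qed.

End input.

(** * Mutual information of the Gaussian input *)

Section gaussian_input.
Variable s : R.
Hypotheses (s0 : 0 < s) (s1 : 1 <= 2 * pi * s).
Variable Q : probability T R.
Hypothesis QE : forall g : T -> \bar R, measurable_fun setT g ->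
  (forall x, 0 <= g x)%E -> (\int[Q]_x g x = \int[mu]_x (g x * (gaussd s x)%:E))%E.

Lemma gaussian_input_mom : (\int[Q]_x (normsq x)%:E = (p%:R * s)%:E)%E.
Proof.
rewrite QE; last by move=> x; rewrite lee_fin normsq_ge0.
  by rewrite -integral_normsq_gaussd.
by apply/measurable_EFinP; exact: measurable_normsq.
Qed.

Let Q_mom : (\int[Q]_x (normsq x)%:E <= (p%:R * s)%:E)%E.
Proof. by rewrite gaussian_input_mom. Qed.

Let q := out_density f Q.
Let A := ln M + p%:R / 2 * ln (2 * pi * s).

Let A0 : 0 <= A.
Proof. by rewrite addr_ge0 ?ln_ge0// mulr_ge0// ln_ge0. Qed.

Let g0 (x : T) : ((0 : \bar R) <= (gaussd s x)%:E)%E.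
Proof. by rewrite lee_fin ltW// gaussd_gt0. Qed.

Let mg : measurable_fun setT (fun x : T => (gaussd s x)%:E).
Proof. by apply/measurable_EFinP; exact: measurable_gaussd. Qed.

Let l0 y : ((0 : \bar R) <= (neglog_out Q y)%:E)%E.
Proof. by rewrite lee_fin; exact: neglog_out_ge0 Q_mom y. Qed.

Let mlq : measurable_fun setT (fun y => (neglog_out Q y)%:E).
Proof. exact: measurable_neglog_out Q_mom. Qed.

(* Gibbs' inequality between the input law and the output law given that the
   noise is [v]; averaged over [v], it says that the mutual information between
   noise and output is nonnegative. *)
Let inner v :
  ((A + p%:R / 2)%:E <= \int[mu]_x ((gaussd s x)%:E * (neglog_out Q (tadd v x))%:E))%E.
Proof.
have mq : measurable_fun setT (fun y : T => (q y)%:E).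
  by apply/measurable_EFinP; exact: measurable_out_density.
have mt : measurable_fun setT (fun x : T => tadd v x).
  exact: (measurableT_comp measurable_tadd (pair1_measurable v)).
have mqv : measurable_fun setT (fun x : T => (q (tadd v x))%:E).
  exact: (measurableT_comp mq mt).
have q0 (x : T) : ((0 : \bar R) <= (q (tadd v x))%:E)%E.
  by rewrite lee_fin ltW// (out_density_gt0 Q_mom).
have mgl : measurable_fun setT (fun x => (gaussd s x)%:E * (neglog_out Q (tadd v x))%:E)%E.
  by apply: emeasurable_funM => //; exact: (measurableT_comp mlq mt).
have gl0 (x : T) : ((0 : \bar R) <= (gaussd s x)%:E * (neglog_out Q (tadd v x))%:E)%E.
  exact: mule_ge0.
have qv1 : (\int[mu]_x (q (tadd v x))%:E = 1)%E.
  under eq_integral do rewrite taddC.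
  by rewrite (integral_tleb_tadd v mq) integral_out_density.
have r0 (x : T) : ((0 : \bar R) <= (normsq x * gaussd s x)%:E)%E.
  by rewrite lee_fin mulr_ge0 ?normsq_ge0// ltW// gaussd_gt0.
have mr : measurable_fun setT (fun x : T => (normsq x * gaussd s x)%:E)%E.
  apply/measurable_EFinP/measurable_funM; first exact: measurable_normsq.
  exact: measurable_gaussd.
have i2s : 0 <= (2 * s)^-1 by rewrite invr_ge0 mulr_ge0// ltW.
have t1 (x : T) : ((0 : \bar R) <= (A + 1)%:E * (gaussd s x)%:E)%E.
  by apply: mule_ge0 => //; rewrite lee_fin addr_ge0.
have m1 : measurable_fun setT (fun x : T => (A + 1)%:E * (gaussd s x)%:E)%E.
  exact: measurable_funeM.
have t2 (x : T) : ((0 : \bar R) <= (2 * s)^-1%:E * (normsq x * gaussd s x)%:E)%E.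
  by apply: mule_ge0 => //; rewrite lee_fin.
have m2 : measurable_fun setT (fun x : T => (2 * s)^-1%:E * (normsq x * gaussd s x)%:E)%E.
  exact: measurable_funeM.
(* The 1 is now the mass of the Gaussian on the left and of the translated q on the right. The term
   p / 2 is the second moment p s divided by 2 s. *)
rewrite -(@leeD2rE _ 1%E)// -{2}qv1 -ge0_integralD//.
apply: (@le_trans _ _ (\int[mu]_x ((A + 1)%:E * (gaussd s x)%:E +
    (2 * s)^-1%:E * (normsq x * gaussd s x)%:E))%E).
  have A10 : 0 <= A + 1 by rewrite addr_ge0.
  rewrite ge0_integralD// !ge0_integralZl_EFin//.
  rewrite integral_gaussd// integral_normsq_gaussd// mule1 -EFinM -!EFinD lee_fin.
  rewrite le_eqVlt; apply/orP; left; apply/eqP.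
  by field; rewrite gt_eqF.
apply: ge0_le_integral => //=.
- by move=> x _; exact: adde_ge0.
- exact: emeasurable_funD.
- exact: emeasurable_funD.
move=> x _; rewrite -!EFinM -!EFinD lee_fin.
have qx := out_density_gt0 Q_mom (tadd v x).
have := gibbs (gaussd_gt0 x s0) qx.
rewrite ln_div ?posrE ?gaussd_gt0// ln_gaussd// (neglog_outE Q_mom) -/q /A => h.
set g := gaussd s x in h *; set lnq := ln (q (tadd v x)) in h *.
have -> : (ln M + p%:R / 2 * ln (2 * pi * s) + 1) * g + (2 * s)^-1 * (normsq x * g)
  = g * ln M + g - g * (- (p%:R / 2 * ln (2 * pi * s) + normsq x / (2 * s))) by ring.
move: h; rewrite !mulrBr; lra.
Qed.

(** After the change of variable y = v + x, Tonelli puts the noise v outside; the bound [inner] does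
    not depend on v and f has mass 1. *)
Let lower : ((A + p%:R / 2)%:E <= \int[mu]_y ((q y)%:E * (neglog_out Q y)%:E))%E.
Proof.
rewrite -integral_output//.
rewrite QE; last 2 first.
- exact: measurable_mean_neglog_out Q_mom.
- by move=> x; apply: integral_ge0 => y _; rewrite mule_ge0// lee_fin.
have mt : measurable_fun setT (fun xv : T * T => tadd xv.2 xv.1).
  apply: (measurableT_comp measurable_tadd (g := fun xv : T * T => (xv.2, xv.1))).
  exact: measurable_swap.
have mF : measurable_fun setT (fun xv : T * T =>
    (f xv.2)%:E * (neglog_out Q (tadd xv.2 xv.1))%:E * (gaussd s xv.1)%:E)%E.
  apply: emeasurable_funM; last exact: (measurableT_comp mg measurable_fst).
  apply: emeasurable_funM; last exact: (measurableT_comp mlq mt).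
  by apply/measurable_EFinP; exact: (measurableT_comp mf measurable_snd).
have F0 (xv : T * T) : ((0 : \bar R) <=
    (f xv.2)%:E * (neglog_out Q (tadd xv.2 xv.1))%:E * (gaussd s xv.1)%:E)%E.
  by rewrite !mule_ge0// lee_fin.
have -> : (\int[mu]_x (\int[mu]_y ((f (tsub y x))%:E * (neglog_out Q y)%:E) * (gaussd s x)%:E) =
  \int[mu]_x \int[mu]_v ((f v)%:E * (neglog_out Q (tadd v x))%:E * (gaussd s x)%:E))%E.
  apply: eq_integral => x _; rewrite (integral_shift_output x mlq) ge0_integralZr//=.
    apply: emeasurable_funM; first exact/measurable_EFinP.
    exact: (measurableT_comp mlq (measurable_taddl x)).
  by move=> v _; rewrite mule_ge0// lee_fin.
rewrite (fubini_tonelli (fun xv : T * T =>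
    (f xv.2)%:E * (neglog_out Q (tadd xv.2 xv.1))%:E * (gaussd s xv.1)%:E)%E)//=.
have Ap0 : 0 <= A + p%:R / 2 by rewrite addr_ge0.
have -> : ((A + p%:R / 2)%:E = \int[mu]_v ((A + p%:R / 2)%:E * (f v)%:E))%E.
  rewrite ge0_integralZl_EFin//; first by rewrite f_int mule1.
  - by move=> v _; rewrite lee_fin.
  - exact/measurable_EFinP.
apply: ge0_le_integral => //=.
- by move=> v _; rewrite mule_ge0// lee_fin.
- by apply: measurable_funeM; exact/measurable_EFinP.
- exact: (measurable_fun_fubini_tonelli_G _ mF F0).
move=> v _; rewrite muleC.
have -> : (\int[mu]_x ((f v)%:E * (neglog_out Q (tadd v x))%:E * (gaussd s x)%:E) =
    (f v)%:E * \int[mu]_x ((gaussd s x)%:E * (neglog_out Q (tadd v x))%:E))%E.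
  rewrite -ge0_integralZl_EFin//.
  - by apply: eq_integral => x _; rewrite -muleA (muleC (neglog_out _ _)%:E).
  - by move=> x _; exact: mule_ge0.
  - apply: emeasurable_funM => //.
    exact: (measurableT_comp mlq (measurableT_comp measurable_tadd (pair1_measurable v))).
by rewrite lee_wpmul2l ?lee_fin.
Qed.

Lemma mutual_info_gaussian_ge :
  ((flnf + p%:R / 2 * ln (2 * pi * s) + p%:R / 2)%:E <= mutual_info_additive f Q)%E.
Proof.
rewrite (mutual_info_additiveE Q_mom).
apply: le_trans (leeD2l _ lower).
rewrite -EFinD lee_fin le_eqVlt; apply/orP; left; apply/eqP; rewrite /A; ring.
Qed.

End gaussian_input.

(** * Two-sided capacity bounds and the limit *)

Lemma capacity_ge (P : R) : p%:R <= P ->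
  ((flnf + p%:R / 2 * ln (2 * pi * P / p%:R) + p%:R / 2)%:E <= capacity f P)%E.
Proof.
move=> pP; have p0 : 0 < p%:R :> R by rewrite ltr0n.
have s0 : 0 < P / p%:R by rewrite divr_gt0// (lt_le_trans p0).
(* P >= p makes the variance at least 1, hence ln (2 pi s) nonnegative, as the nonnegative integrals
   above require. *)
have s1 : 1 <= 2 * pi * (P / p%:R).
  have P1 : 1 <= P / p%:R by rewrite ler_pdivlMr// mul1r.
  apply: le_trans P1 _; rewrite ler_peMl ?(ltW s0)//.
  by have := pi_ge2 R; lra.
have [Q QE] := density_probability (@measurable_gaussd R p (P / p%:R))
  (fun x => ltW (gaussd_gt0 x s0)) (@integral_gaussd R p _ s0).
rewrite -(mulrA (2 * pi)); apply: le_trans (mutual_info_gaussian_ge s0 s1 QE) _.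
apply: ereal_sup_ubound; exists Q => //=.
by rewrite (gaussian_input_mom s0 QE) lee_fin mulrC divfK// gt_eqF.
Qed.

(** With s = P / p the moment term ((1 + e) P + (1 + 1/e) c) / (2 s) splits into p / 2, which
    matches the lower bound, and the excess. *)
Lemma capacity_le (P e : R) : p%:R <= P -> 0 < e ->
  (capacity f P <= (flnf + p%:R / 2 * ln (2 * pi * P / p%:R) + p%:R / 2 +
    p%:R / 2 * (e + (1 + e^-1) * c / P))%:E)%E.
Proof.
move=> pP e0; have p0 : 0 < p%:R :> R by rewrite ltr0n.
have P0 : 0 < P by rewrite (lt_le_trans p0).
have s0 : 0 < P / p%:R by rewrite divr_gt0.
have s1 : 1 <= 2 * pi * (P / p%:R).
  have P1 : 1 <= P / p%:R by rewrite ler_pdivlMr// mul1r.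
  apply: le_trans P1 _; rewrite ler_peMl ?(ltW s0)//.
  by have := pi_ge2 R; lra.
apply: ge_ereal_sup => _ [PX /= PXP <-].
apply: le_trans (mutual_info_le PXP s0 s1 e0) _.
rewrite lee_fin le_eqVlt; apply/orP; left; apply/eqP; rewrite mulrA.
by field; rewrite !gt_eqF.
Qed.

Lemma diff_entropyE : diff_entropy f = (- flnf)%:E.
Proof. by rewrite /diff_entropy integral_lebesgue_p flnfE. Qed.

Theorem capacity_asymptotics :
  (capacity f P - ((p%:R / 2 * ln P)%:E +
    ((p%:R / 2 * ln (2 * pi * expR 1 / p%:R))%:E - diff_entropy f)))%E
  @[P --> +oo%R] --> 0%E.
Proof.
have p0 : 0 < p%:R :> R by rewrite ltr0n.
have DE (P : R) : 0 < P -> p%:R / 2 * ln P +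
    (p%:R / 2 * ln (2 * pi * expR 1 / p%:R) + flnf) =
    flnf + p%:R / 2 * ln (2 * pi * P / p%:R) + p%:R / 2.
  move=> P0.
  have t0 : 0 < 2 * pi :> R by rewrite mulr_gt0// pi_gt0.
  rewrite !ln_div ?posrE ?mulr_gt0 ?expR_gt0 ?pi_gt0//.
  rewrite !(lnM (x := 2 * pi)) ?posrE ?expR_gt0//.
  by rewrite expRK; ring.
pose D P := p%:R / 2 * ln P + (p%:R / 2 * ln (2 * pi * expR 1 / p%:R) + flnf).
have sandwich (P e : R) : p%:R <= P -> 0 < e ->
    (0 <= capacity f P - (D P)%:E)%E /\
    (capacity f P - (D P)%:E <= (p%:R / 2 * (e + (1 + e^-1) * c / P))%:E)%E.
  move=> pP e0; have P0 : 0 < P by exact: lt_le_trans pP.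
  rewrite /D DE//; split.
    by rewrite sube_ge0// capacity_ge.
  by rewrite leeBlDl// -EFinD capacity_le.
rewrite (_ : (fun P => _) = (fun P => capacity f P - (D P)%:E)%E); last first.
  by apply/funext => P; rewrite diff_entropyE EFinN oppeK -!EFinD.
(* Eventual finiteness comes from the sandwich with e = 1; real convergence follows with e adapted
   to the tolerance. *)
apply/fine_cvgP; split.
  near=> P; have pP : p%:R <= P by near: P; apply: nbhs_pinfty_ge; rewrite num_real.
  have [h1 h2] := sandwich _ _ pP ltr01.
  by rewrite ge0_fin_numE// (le_lt_trans h2)// ltry.
apply/cvgrPdist_le => /= d d0; near=> P.
have pP : p%:R <= P by near: P; apply: nbhs_pinfty_ge; rewrite num_real.
have P0 : 0 < P by exact: lt_le_trans pP.
(* This e contributes d / 2 to the gap. The other d / 2 bounds the term in c / P once P >= p (1 +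
   1/e) c / d. *)
pose e := d / p%:R; have e0 : 0 < e by rewrite divr_gt0.
have [h1 h2] := sandwich _ _ pP e0.
have fn : (capacity f P - (D P)%:E)%E \is a fin_num.
  by rewrite ge0_fin_numE// (le_lt_trans h2)// ltry.
rewrite sub0r normrN ger0_norm ?fine_ge0//.
rewrite -lee_fin fineK//; apply: (le_trans h2); rewrite lee_fin.
have PB : p%:R * (1 + e^-1) * c / d <= P.
  by near: P; apply: nbhs_pinfty_ge; rewrite num_real.
have hP : p%:R * ((1 + e^-1) * c / P) <= d.
  have -> : p%:R * ((1 + e^-1) * c / P) = p%:R * (1 + e^-1) * c / P.
    by rewrite !mulrA.
  by rewrite ler_pdivrMr// -ler_pdivrMl// mulrC.
have -> : p%:R / 2 * (e + (1 + e^-1) * c / P) =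
    d / 2 + p%:R * ((1 + e^-1) * c / P) / 2.
  by rewrite /e; field; rewrite !gt_eqF.
by lra.
Unshelve. all: by end_near. Qed.

End channel.

(** * Bessel functions *)

Section line_integrals.
Set Implicit Arguments.
Unset Strict Implicit.
Context {R : realType}.
Local Notation mu := (@lebesgue_measure R).
Implicit Types (a b u t : R).

Lemma ge0_integral_lebesgue_opp (f : R -> \bar R) :
  measurable_fun setT f -> (forall x, 0 <= f x)%E ->
  (\int[mu]_x f (- x)%R = \int[mu]_x f x)%E.
Proof.
move=> mf f0.
pose phi (x : measurableTypeR R) : measurableTypeR R := (- x)%R.
have mphi : measurable_fun setT phi by exact: measurableT_comp.
pose m : {measure set (measurableTypeR R) -> \bar R} :=
  measure_function_pushforward__canonical__measure_function_Measure
    (mu : {measure set _ -> \bar R}) mphi.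
transitivity (\int[m]_x f x)%E; first by rewrite ge0_integral_pushforward.
by apply: eq_measure_integral => A mA _; exact: lebesgue_measureN.
Qed.

(* Unlike the library's change of variables on the whole line, this one does
   not ask [F^`()] to have finite limits at infinity. *)
Lemma integral_subst_line (F G : R -> R) :
  {homo F : x y / x < y} -> (forall x, derivable F x 1) -> continuous (derive1 F) ->
  (forall y, exists k : nat, F (- k%:R) <= y <= F k%:R) ->
  continuous G -> (forall x, 0 <= G x) ->
  (\int[mu]_x (G x)%:E = \int[mu]_x (G (F x) * derive1 F x)%:E)%E.
Proof.
move=> incF dF cF' Foo cG G0.
have cF : continuous F.
  by move=> x; exact/differentiable_continuous/derivable1_diffP/dF.
have F'0 x : 0 <= derive1 F x.
  apply: (@incr_derive1_ge0 _ _ setT) => //; first by move=> ? ? _ _; exact: incF.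
  by rewrite interiorT.
have mG : measurable_fun setT (EFin \o G).
  by apply/measurable_EFinP; exact: continuous_measurable_fun.
have mGF : measurable_fun setT (fun x => (G (F x) * derive1 F x)%:E).
  apply/measurable_EFinP; apply: measurable_funM; last exact: continuous_measurable_fun.
  apply: measurableT_comp; exact: continuous_measurable_fun.
have lehomo : {homo F : x y / x <= y}.
  by move=> x y; rewrite le_eqVlt => /predU1P[->//|/incF/ltW].
have kk (k l : nat) : (k <= l)%N -> [/\ (k%:R <= l%:R :> R) & (- l%:R <= - k%:R :> R)].
  by move=> kl; rewrite lerN2 ler_nat.
(* The substitution is made on [[-k, k]] and its image; monotone convergence then lets k grow, both
   families exhausting the line. *)
pose D (k : nat) : set R := `[(- k%:R)%R, k%:R]%classic.
pose D' (k : nat) : set R := `[F (- k%:R)%R, F k%:R]%classic.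
have DT : \bigcup_k D k = setT.
  rewrite -subTset => x _; exists (Num.bound `|x|) => //=; rewrite /D/= in_itv/= -ler_norml.
  exact: ltW (archi_boundP (normr_ge0 x)).
have D'T : \bigcup_k D' k = setT.
  by rewrite -subTset => y _; have [k ky] := Foo y; exists k => //=; rewrite /D'/= in_itv.
have ndD : nondecreasing_seq D.
  move=> k l /kk[h1 h2]; rewrite subsetEset => x; rewrite /D/= !in_itv/= => /andP[h3 h4].
  by rewrite (le_trans h2)//= (le_trans h4).
have ndD' : nondecreasing_seq D'.
  move=> k l /kk[h1 h2]; rewrite subsetEset => x; rewrite /D'/= !in_itv/= => /andP[h3 h4].
  by rewrite (le_trans (lehomo _ _ h2))//= (le_trans h4)// lehomo.
have cv1 : (\int[mu]_(x in D' k) (G x)%:E @[k --> \oo] -->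
    \int[mu]_(x in \bigcup_k D' k) (G x)%:E)%E.
  apply: ge0_nondecreasing_set_cvg_integral => //.
  - by move=> k; exact: measurable_itv.
  - by move=> k; exact: measurable_funTS.
  - by move=> k x _; rewrite lee_fin.
have cv2 : (\int[mu]_(x in D k) (G (F x) * derive1 F x)%:E @[k --> \oo] -->
    \int[mu]_(x in \bigcup_k D k) (G (F x) * derive1 F x)%:E)%E.
  apply: ge0_nondecreasing_set_cvg_integral => //.
  - by move=> k; exact: measurable_itv.
  - by move=> k; exact: measurable_funTS.
  - by move=> k x _; rewrite lee_fin mulr_ge0.
have E : (fun k => \int[mu]_(x in D' k) (G x)%:E)%E =
         (fun k => \int[mu]_(x in D k) (G (F x) * derive1 F x)%:E)%E.
  apply/funext => k; apply: integration_by_substitution_increasing.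
  - by rewrite ge0_cp// ler0n.
  - by move=> x y _ _; exact: incF.
  - by move=> x _; exact: cF'.
  - apply/cvg_ex; exists (derive1 F (- k%:R)); apply: cvg_at_right_filter; exact: cF'.
  - apply/cvg_ex; exists (derive1 F k%:R); apply: cvg_at_left_filter; exact: cF'.
  - split => //.
    + by apply: cvg_at_right_filter; exact: cF.
    + by apply: cvg_at_left_filter; exact: cF.
  - exact: continuous_subspaceT.
move: cv1 cv2; rewrite DT D'T E => cv1 cv2.
exact: (cvg_unique _ cv1 cv2).
Qed.

(* With [b = 1] this is the integrand of [2 * besselK a u]; with
   [b = lam ^+ 2 + normsq x] it is the mixture kernel of the noise density. *)
Definition bexp u a b t : R := expR (a * t - u / 2 * (b * expR t + expR (- t))).

Lemma bexp_gt0 u a b t : 0 < bexp u a b t.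
Proof. exact: expR_gt0. Qed.

Lemma continuous_bexp u a b : continuous (bexp u a b).
Proof.
move=> t; rewrite /bexp.
apply: continuous_comp; last exact: continuous_expR.
apply: cvgB; first by apply: cvgM; [exact: cvg_cst|exact: cvg_id].
apply: cvgM; first exact: cvg_cst.
apply: cvgD.
  by apply: cvgM; [exact: cvg_cst|exact: continuous_expR].
apply: (continuous_comp (f := -%R) (g := expR)); last exact: continuous_expR.
exact: continuousN.
Qed.

Lemma measurable_bexp u a b : measurable_fun setT (bexp u a b).
Proof. by apply: continuous_measurable_fun; exact: continuous_bexp. Qed.

(** A quadratic lower bound, enough to dominate [bexp] by a Gaussian. For t >= 0, square exp (t / 2)
    >= t / 2. *)
Lemma expRDN_ge t : t ^+ 2 / 4 <= expR t + expR (- t).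
Proof.
wlog t0 : t / 0 <= t.
  move=> h; have [/h//|/ltW t0] := leP 0 t.
  by have := h (- t); rewrite oppr_ge0 => /(_ t0); rewrite sqrrN opprK addrC.
have h := expR_ge1Dx (t / 2).
have e0 := expR_ge0 (- t).
have -> : expR t = expR (t / 2) ^+ 2 by rewrite expr2 -expRD; congr expR; field.
have : (t / 2) ^+ 2 <= expR (t / 2) ^+ 2.
  by rewrite ler_pXn2r// ?nnegrE ?expR_ge0 ?divr_ge0//; lra.
rewrite expr_div_n (_ : 2 ^+ 2 = 4 :> R); last by ring.
by lra.
Qed.

Lemma integral_bexp_lty u a b : 0 < u -> 0 < b ->
  (\int[mu]_t (bexp u a b t)%:E < +oo)%E.
Proof.
move=> u0 b0; pose m := Num.min b 1; have m0 : 0 < m by rewrite lt_min b0 ltr01.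
(* s is chosen so that (u / 2) m t^2 / 4 = t^2 / (2 s); the mean c = a s then completes the square
   with the linear term a t. *)
pose s := 4 / (u * m); have s0 : 0 < s by rewrite divr_gt0// mulr_gt0.
pose c := a * s.
pose K := expR (c ^+ 2 / (2 * s)).
apply: (@le_lt_trans _ _ (\int[mu]_t (K%:E * (expR (- ((t - c) ^+ 2 / (2 * s))))%:E))%E).
  have mg : measurable_fun setT (fun t : R => (expR (- ((t - c) ^+ 2 / (2 * s))))%:E).
    apply/measurable_EFinP; apply: measurableT_comp => //.
    apply: measurableT_comp => //; apply: measurable_funM => //.
    by apply: measurable_funX; exact: measurable_funB.
  apply: ge0_le_integral => //=.
  - by move=> t _; rewrite lee_fin ltW// bexp_gt0.
  - by apply/measurable_EFinP; exact: measurable_bexp.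
  - exact: measurable_funeM.
  move=> t _; rewrite -EFinM lee_fin -expRD ler_expR.
  have -> : c ^+ 2 / (2 * s) - (t - c) ^+ 2 / (2 * s) = a * t - t ^+ 2 / (2 * s).
    by rewrite /c; field; rewrite gt_eqF.
  rewrite lerD2l lerN2.
  have -> : t ^+ 2 / (2 * s) = u / 2 * (m * (t ^+ 2 / 4)).
    by rewrite /s; field; rewrite !gt_eqF.
  rewrite ler_pM2l ?divr_gt0//.
  apply: (@le_trans _ _ (m * (expR t + expR (- t)))).
    by rewrite ler_pM2l// expRDN_ge.
  rewrite mulrDr lerD//; first by rewrite ler_pM2r ?expR_gt0// ge_min lexx.
  by rewrite ger_pMl ?expR_gt0// ge_min lexx orbT.
rewrite ge0_integralZl_EFin ?expR_ge0//.
  by rewrite integral_gauss1// -EFinM ltry.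
apply/measurable_EFinP; apply: measurableT_comp => //.
apply: measurableT_comp => //; apply: measurable_funM => //.
by apply: measurable_funX; exact: measurable_funB.
Qed.

Lemma integral_bexpN u a : 
  (\int[mu]_t (bexp u (- a) 1 t)%:E = \int[mu]_t (bexp u a 1 t)%:E)%E.
Proof.
rewrite -ge0_integral_lebesgue_opp.
- apply: eq_integral => t _; congr (expR _)%:E.
  by rewrite opprK !mul1r mulrNN (addrC (expR t)).
- by apply/measurable_EFinP; exact: measurable_bexp.
- by move=> t; rewrite lee_fin ltW// bexp_gt0.
Qed.

(** The integrand is even and is half the sum of the [bexp] at nu and at - nu, which have the same
    integral by reflection. The half-line therefore contributes half of one full integral, finite by
    [integral_bexp_lty]. *)
Lemma besselKE nu x : 0 < x ->
  ((besselK nu x)%:E = 2^-1%:E * \int[mu]_t (bexp x nu 1 t)%:E)%E.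
Proof.
move=> x0; pose G t : R := expR (- (x * coshR t)) * coshR (nu * t).
have GE t : G t = 2^-1 * bexp x nu 1 t + 2^-1 * bexp x (- nu) 1 t.
  rewrite /G /bexp /coshR mul1r !expRD (_ : - nu * t = - (nu * t)) ?mulNr//.
  rewrite (_ : x / 2 * (expR t + expR (- t)) = x * ((expR t + expR (- t)) / 2)).
    by field.
  by ring.
have G0 t : 0 <= G t by rewrite GE addr_ge0// mulr_ge0// ltW// bexp_gt0.
have cG : continuous G.
  rewrite (_ : G = fun t => 2^-1 * bexp x nu 1 t + 2^-1 * bexp x (- nu) 1 t).
    move=> t; apply: cvgD.
      by apply: cvgM; [exact: cvg_cst|exact: continuous_bexp].
    by apply: cvgM; [exact: cvg_cst|exact: continuous_bexp].
  by apply/funext => t; rewrite GE.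
have GN : G =1 G \o -%R.
  by move=> t; rewrite /G/= /coshR mulrN !opprK (addrC (expR (- t))) (addrC (expR (- (nu * t)))).
have := ge0_symfun_integralT G0 cG GN.
rewrite -set_itvcy => GT.
have mb a : measurable_fun setT (fun t => (bexp x a 1 t)%:E).
  by apply/measurable_EFinP; exact: measurable_bexp.
have b0 a t : (0 <= (bexp x a 1 t)%:E)%E by rewrite lee_fin ltW// bexp_gt0.
have GI : (\int[mu]_t (G t)%:E = \int[mu]_t (bexp x nu 1 t)%:E)%E.
  under eq_integral do rewrite GE EFinD !EFinM.
  have Z a : (\int[mu]_t (2^-1%:E * (bexp x a 1 t)%:E) =
      2^-1%:E * \int[mu]_t (bexp x a 1 t)%:E)%E.
    by rewrite ge0_integralZl_EFin//; exact: mb.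
  have h2 : 2^-1 + 2^-1 = 1 :> R by field.
  have Z0 a t : (0 <= 2^-1%:E * (bexp x a 1 t)%:E)%E.
    by rewrite -EFinM lee_fin mulr_ge0// ltW// bexp_gt0.
  have mZ a : measurable_fun setT (fun t => 2^-1%:E * (bexp x a 1 t)%:E)%E.
    by apply: measurable_funeM; exact: mb.
  transitivity (\int[mu]_t (2^-1%:E * (bexp x nu 1 t)%:E) +
                \int[mu]_t (2^-1%:E * (bexp x (- nu) 1 t)%:E))%E.
    by apply: ge0_integralD => //; (try exact: mZ) => t _; exact: Z0.
  rewrite (Z nu) (Z (- nu)) integral_bexpN -ge0_muleDl ?lee_fin//.
  by rewrite -EFinD h2 mul1e.
rewrite -GI GT muleA -EFinM mulVf ?mul1e// /besselK fineK//.
rewrite ge0_fin_numE; last by apply: integral_ge0 => t _; rewrite lee_fin G0.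
have : (\int[mu]_t (G t)%:E < +oo)%E by rewrite GI integral_bexp_lty.
rewrite GT => h; apply: le_lt_trans h.
by rewrite lee_pemull ?lee_fin ?ler1n//; apply: integral_ge0 => t _; rewrite lee_fin G0.
Qed.

End line_integrals.

(** * Closed form at exponent one half *)

Section bexp_half.
Set Implicit Arguments.
Unset Strict Implicit.
Context {R : realType}.
Local Notation mu := (@lebesgue_measure R).
Implicit Types (u lam t : R).

Lemma integral_bexp_shift u a b (r : R) :
  (\int[mu]_t (bexp u a b (t - r))%:E = \int[mu]_t (bexp u a b t)%:E)%E.
Proof.
apply: (ge0_integral_lebesgue_shift (fun t => (bexp u a b t)%:E)).
- by apply/measurable_EFinP; exact: measurable_bexp.
- by move=> t; rewrite lee_fin ltW// bexp_gt0.
Qed.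

(** The reflection t |-> - t - 2 ln lam exchanges lam^2 exp t and exp (- t), and multiplies the
    half-power factor by lam while inverting it. *)
Lemma integral_bexp_Nhalf u lam : 0 < lam ->
  (\int[mu]_t (bexp u (- 2^-1) (lam ^+ 2) t)%:E =
   lam%:E * \int[mu]_t (bexp u 2^-1 (lam ^+ 2) t)%:E)%E.
Proof.
move=> l0.
have mb a b : measurable_fun setT (fun t => (bexp u a b t)%:E).
  by apply/measurable_EFinP; exact: measurable_bexp.
have b0 a b t : (0 <= (bexp u a b t)%:E)%E by rewrite lee_fin ltW// bexp_gt0.
rewrite -(ge0_integral_lebesgue_opp (mb _ _) (b0 _ _)).
pose g t := (bexp u (- 2^-1) (lam ^+ 2) (- t))%:E.
have mg : measurable_fun setT g by exact: (measurableT_comp (mb _ _)).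
rewrite -(ge0_integral_lebesgue_shift g (- (2 * ln lam)) mg (fun t => b0 _ _ _)).
rewrite -ge0_integralZl_EFin ?(ltW l0)//; last exact: mb.
apply: eq_integral => t _; rewrite /g/bexp -EFinM; congr EFin.
have el : lam = expR (ln lam) by rewrite lnK ?posrE.
rewrite [X in _ = X * _]el -expRD; congr expR.
have e2 : expR (2 * ln lam) = lam ^+ 2 by rewrite expRM_natl lnK ?posrE.
rewrite !opprK !opprD !expRD !(expRN (2 * _)) e2 !expRN.
by field; rewrite !gt_eqF// expR_gt0.
Qed.

(** Substitute y = lam exp (t/2) - exp (- t/2), for which y^2 = lam^2 exp t + exp (- t) - 2 lam. The
    Gaussian integral of variance 1/u in y becomes exp (lam u) times a combination of the integrals
    at 1/2 and - 1/2, and [integral_bexp_Nhalf] reduces it to the former. *)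
Lemma integral_bexp_half u lam : 0 < u -> 0 < lam ->
  (\int[mu]_t (bexp u 2^-1 (lam ^+ 2) t)%:E =
   (Num.sqrt (2 * pi / u) / lam * expR (- (lam * u)))%:E)%E.
Proof.
move=> u0 l0.
have e1 t : expR (t / 2) * expR (- (t / 2)) = 1 by rewrite -expRD subrr expR0.
have e2 t : expR t = expR (t / 2) ^+ 2 by rewrite expr2 -expRD; congr expR; field.
have e3 t : expR (- t) = expR (- (t / 2)) ^+ 2.
  by rewrite expr2 -expRD; congr expR; field.
pose F t := lam * expR (t / 2) - expR (- (t / 2)).
pose F' t := (lam * expR (t / 2) + expR (- (t / 2))) / 2.
have dF t : is_derive t 1 F (F' t).
  rewrite /F /F'.
  have h1 : is_derive t 1 (fun x : R => x / 2) 2^-1.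
    have h := is_deriveM (is_derive_id t (1 : R)) (is_derive_cst (2^-1 : R) t (1 : R)).
    by apply: (is_derive_eq h); rewrite scaler0 add0r /GRing.scale/= mulr1.
  have h2 : is_derive t 1 (fun x : R => - (x / 2)) (- 2^-1) by exact: is_deriveN.
  have h3 := @is_derive1_comp R expR (fun x => x / 2) t _ _ (is_derive_expR _) h1.
  have h4 := @is_derive1_comp R expR (fun x => - (x / 2)) t _ _ (is_derive_expR _) h2.
  apply: (is_derive_eq (is_deriveB (is_deriveZ lam h3) h4)).
  by rewrite /GRing.scale/=; field.
have F'E : derive1 F = F'.
  by apply/funext => t; rewrite derive1E; exact: derive_val.
pose G y : R := expR (- ((y - 0) ^+ 2 / (2 * u^-1))).
have cexp (a : R) : continuous (fun t : R => expR (a * t)).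
  move=> t; apply: (continuous_comp (f := fun t : R => a * t) (g := expR)).
    by apply: cvgM; [exact: cvg_cst|exact: cvg_id].
  exact: continuous_expR.
have F'E' : F' = fun t => lam / 2 * expR (2^-1 * t) + 2^-1 * expR (- 2^-1 * t).
  by apply/funext => t; rewrite /F' mulNr (mulrC 2^-1 t); field.
have cF' : continuous F'.
  rewrite F'E' => t; apply: cvgD.
    by apply: cvgM; [exact: cvg_cst|exact: cexp].
  by apply: cvgM; [exact: cvg_cst|exact: cexp].
have cG : continuous G.
  move=> y; apply: (continuous_comp
    (f := fun y : R => - ((y - 0) ^+ 2 / (2 * u^-1))) (g := expR)); last exact: continuous_expR.
  apply: cvgN; apply: cvgM; last exact: cvg_cst.
  apply: (continuous_comp (f := fun y : R => y - 0) (g := fun y : R => y ^+ 2)).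
    by apply: cvgB; [exact: cvg_id|exact: cvg_cst].
  exact: exprn_continuous.
have incF : {homo F : x y / x < y}.
  move=> x y xy; rewrite /F ltr_leB//.
    by rewrite ltr_pM2l// ltr_expR ltr_pM2r.
  by rewrite ler_expR lerN2 ler_pM2r// ltW.
have Foo y : exists k : nat, F (- k%:R) <= y <= F k%:R.
  (* B makes lam k / 2 >= |y| + 1 and k / 2 >= |y| + lam; with exp x >= 1 + x these give F k >= |y|
     and F (- k) <= - |y|. *)
  pose Y := (`|y| + 1) / lam; pose B := 2 * (Y + (`|y| + lam)).
  have yY : `|y| + 1 = lam * Y by rewrite /Y; field; rewrite gt_eqF.
  have ny := normr_ge0 y.
  have Y0 : 0 <= Y by rewrite divr_ge0 ?addr_ge0// ltW.
  have B0 : 0 <= B by rewrite mulr_ge0// !addr_ge0// ltW.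
  exists (Num.bound B); set k := Num.bound B.
  have kB : B < k%:R := archi_boundP B0.
  have k0 : 0 <= k%:R :> R := ler0n _ _.
  have h1 := expR_ge1Dx (k%:R / 2 : R).
  have h2 : expR (- (k%:R / 2)) <= 1 :> R by rewrite -expR0 ler_expR oppr_le0 divr_ge0.
  have h3 := expR_ge0 (- (k%:R / 2) : R).
  have ly : `|y| + 1 <= lam * (k%:R / 2).
    by rewrite yY ler_pM2l//; move: kB; rewrite /B; lra.
  have lk : `|y| + lam <= k%:R / 2 by move: kB; rewrite /B; lra.
  have [y1 y2] : y <= `|y| /\ - `|y| <= y.
    by have := ler_norm y; have := ler_norm (- y); rewrite normrN => ? ?; split; lra.
  rewrite /F mulNr opprK; apply/andP; split.
    have : lam * expR (- (k%:R / 2)) <= lam by rewrite ger_pMr.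
    by lra.
  have : lam * (1 + k%:R / 2) <= lam * expR (k%:R / 2) by rewrite ler_pM2l.
  by rewrite mulrDr mulr1; lra.
have := integral_subst_line (F := F) (G := G) incF.
rewrite F'E => /(_ (fun t => ex_derive)) /(_ cF' Foo cG) /(_ (fun x => expR_ge0 _)).
rewrite integral_gauss1 ?invr_gt0//.
have GE t : G (F t) * F' t = expR (lam * u) * (lam / 2 * bexp u 2^-1 (lam ^+ 2) t) +
    expR (lam * u) * (2^-1 * bexp u (- 2^-1) (lam ^+ 2) t).
  rewrite /G subr0 F'E' /bexp.
  have -> : - (F t ^+ 2 / (2 * u^-1)) =
      lam * u - u / 2 * (lam ^+ 2 * expR t + expR (- t)).
    rewrite /F (e2 t) (e3 t); have := e1 t.
    set a := expR (t / 2); set b := expR (- (t / 2)) => ab.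
    have -> : lam * u = lam * u * (a * b) by rewrite ab mulr1.
    by field; rewrite gt_eqF.
  by rewrite !expRD; ring.
under eq_integral do rewrite GE EFinD !EFinM.
have mb a b : measurable_fun setT (fun t => (bexp u a b t)%:E).
  by apply/measurable_EFinP; exact: measurable_bexp.
have b0 a b t : (0 <= (bexp u a b t)%:E)%E by rewrite lee_fin ltW// bexp_gt0.
have Z (r1 r2 a b : R) : 0 <= r1 -> 0 <= r2 ->
    (\int[mu]_t (r1%:E * (r2%:E * (bexp u a b t)%:E)) =
     r1%:E * (r2%:E * \int[mu]_t (bexp u a b t)%:E))%E.
  move=> r10 r20; rewrite ge0_integralZl_EFin//.
  - by rewrite ge0_integralZl_EFin//; exact: mb.
  - by move=> t _; rewrite -EFinM lee_fin mulr_ge0// ltW// bexp_gt0.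
  - by apply: measurable_funeM; exact: mb.
set J := (\int[mu]_t (bexp u 2^-1 (lam ^+ 2) t)%:E)%E.
have Jfin : J \is a fin_num.
  rewrite ge0_fin_numE; first by rewrite integral_bexp_lty// exprn_gt0.
  by apply: integral_ge0 => t _; exact: b0.
have mz (r1 r2 a b : R) :
    measurable_fun setT (fun t => r1%:E * (r2%:E * (bexp u a b t)%:E))%E.
  by do 2 apply: measurable_funeM; exact: mb.
have l20 : 0 <= lam / 2 by rewrite divr_ge0// ltW.
rewrite [X in _ = X -> _](_ : _ =
    (\int[mu]_t ((expR (lam * u))%:E * ((lam / 2)%:E * (bexp u 2^-1 (lam ^+ 2) t)%:E)) +
     \int[mu]_t ((expR (lam * u))%:E *
       (2^-1%:E * (bexp u (- 2^-1) (lam ^+ 2) t)%:E)))%E); last first.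
  apply: ge0_integralD => //; first
    [exact: mz | by move=> t _; rewrite -!EFinM lee_fin !mulr_ge0 ?expR_ge0// ltW// bexp_gt0].
rewrite (Z _ _ _ _ (expR_ge0 _) l20) Z ?expR_ge0//.
rewrite integral_bexp_Nhalf// -/J -(fineK Jfin) -!EFinM -EFinD => -[h].
congr EFin; rewrite [Num.sqrt _](_ : _ = expR (lam * u) * (lam * fine J)).
  by rewrite expRN; field; rewrite !gt_eqF ?expR_gt0.
by rewrite h; field.
Qed.
End bexp_half.

(** * The NDFHL density *)

Section ndfhl.
Set Implicit Arguments.
Unset Strict Implicit.
Context {R : realType} {n : nat}.
Local Notation T := (n.+1.-tuple R).
Local Notation mu := (tleb n.+1).
Local Notation leb := (@lebesgue_measure R).
Variables (lam u : R).
Hypotheses (lam0 : 0 < lam) (u0 : 0 < u).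

Let hd : R := n.+2%:R / 2.
Let f : T -> R := @ndfhl_density R n.+2 lam u.
(** The factor 1/2 comes from [besselKE]; the power of rho in the density is cancelled by the
    translation of t. *)
Let cst : R :=
  lam / (2 `^ (hd - 1) * pi `^ hd) * u `^ hd * expR (lam * u) / 2.

Let hd0 : 0 <= hd. Proof. exact: divr_ge0. Qed.

Let cst_gt0 : 0 < cst.
Proof. by rewrite !(divr_gt0, mulr_gt0) ?powR_gt0 ?pi_gt0 ?expR_gt0. Qed.

(** Of the d factors sqrt (2 pi / u), d - 1 come from the Gaussian mass and the last one from
    [integral_bexp_half]. *)
Let cstE : cst * Num.sqrt (2 * pi / u) ^+ n.+2 = lam * expR (lam * u).
Proof.
have pu0 : 0 < 2 * pi / u by rewrite divr_gt0 ?mulr_gt0 ?pi_gt0.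
rewrite -powR12_sqrt ?(ltW pu0)// -powR_mulrn ?powR_ge0// -powRrM mulrC.
rewrite (_ : 2^-1 * n.+2%:R = hd); last by rewrite mulrC.
rewrite powRM ?invr_ge0 ?(ltW u0)//; last by rewrite mulr_ge0 ?pi_ge0.
rewrite powRM ?pi_ge0// /cst powRB; last by rewrite pnatr_eq0 implybT.
rewrite powRr1// -powR_inv1 ?(ltW u0)// -powRrM mulN1r powRN.
by field; rewrite !gt_eqF ?powR_gt0 ?pi_gt0.
Qed.

Lemma ndfhl_densityE (x : T) :
  ((f x)%:E = cst%:E * \int[leb]_t (bexp u hd (normsq x + lam ^+ 2) t)%:E)%E.
Proof.
pose rho := Num.sqrt (normsq x + lam ^+ 2).
have r20 : 0 < normsq x + lam ^+ 2 by rewrite ltr_wpDl ?normsq_ge0 ?exprn_gt0.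
have rho0 : 0 < rho by rewrite sqrtr_gt0.
have rho2 : normsq x + lam ^+ 2 = rho ^+ 2 by rewrite sqr_sqrtr// ltW.
have rhoE : rho `^ hd = expR (hd * ln rho) by rewrite /powR gt_eqF.
have b0 a (b : R) t : (0 <= (bexp u a b t)%:E)%E by rewrite lee_fin ltW// bexp_gt0.
have shift : (\int[leb]_t (bexp (u * rho) hd 1 t)%:E =
    (rho `^ hd)%:E * \int[leb]_t (bexp u hd (normsq x + lam ^+ 2) t)%:E)%E.
  rewrite -(integral_bexp_shift (u * rho) hd 1 (- ln rho)).
  rewrite -ge0_integralZl_EFin ?powR_ge0//; last first.
    by apply/measurable_EFinP; exact: measurable_bexp.
  apply: eq_integral => t _; rewrite -EFinM; congr EFin.
  rewrite rhoE /bexp -expRD rho2 opprK; congr expR.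
  rewrite opprD !expRD expRN (expRN (ln rho)) lnK ?posrE//.
  by field; rewrite !gt_eqF// expR_gt0.
rewrite /f /ndfhl_density -/hd -/rho EFinM besselKE ?mulr_gt0// shift.
rewrite !muleA -!EFinM; congr (_%:E * _)%E.
rewrite powRM ?invr_ge0 ?(ltW u0) ?(ltW rho0)//.
rewrite -(powR_inv1 (ltW rho0)) -powRrM mulN1r powRN /cst.
by field; rewrite !gt_eqF ?powR_gt0 ?pi_gt0.
Qed.

Let measurable_kernel : measurable_fun setT
  (fun xt : T * measurableTypeR R => (bexp u hd (normsq xt.1 + lam ^+ 2) xt.2)%:E).
Proof.
have ms : measurable_fun setT (fun xt : T * measurableTypeR R => xt.2 : R).
  exact: measurable_snd.
have mn : measurable_fun setT (fun xt : T * measurableTypeR R => normsq xt.1).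
  exact: (measurableT_comp (@measurable_normsq R n.+1) measurable_fst).
apply/measurable_EFinP; apply: measurableT_comp => //.
apply: measurable_funB; first exact: measurable_funM.
apply: measurable_funM => //; apply: measurable_funD.
  by apply: measurable_funM; [exact: measurable_funD|exact: measurableT_comp].
apply: measurableT_comp => //; exact: measurableT_comp.
Qed.

Let kernel_ge0 (xt : T * measurableTypeR R) :
  ((0 : \bar R) <= (bexp u hd (normsq xt.1 + lam ^+ 2) xt.2)%:E)%E.
Proof. by rewrite lee_fin ltW// bexp_gt0. Qed.

Lemma measurable_ndfhl_density : measurable_fun setT f.
Proof.
apply/measurable_EFinP.
rewrite (_ : EFin \o f = fun x =>
    cst%:E * \int[leb]_t (bexp u hd (normsq x + lam ^+ 2) t)%:E)%E.
  apply: measurable_funeM.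
  exact: (@measurable_fun_fubini_tonelli_F _ _ _ _ _ leb _ measurable_kernel kernel_ge0).
by apply/funext => x /=; rewrite ndfhl_densityE.
Qed.

Let bexpE (x : T) t : bexp u hd (normsq x + lam ^+ 2) t =
  bexp u hd (lam ^+ 2) t * gaussfun (expR (- t) / u) x.
Proof.
rewrite /bexp /gaussfun -expRD; congr expR; rewrite expRN.
by field; rewrite !gt_eqF// expR_gt0.
Qed.

(** Tonelli reduces moments of f to Gaussian ones; applied with h = 1 and h = |x|^2. *)
Let integral_ndfhl (h : T -> R) : measurable_fun setT h -> (forall x, 0 <= h x) ->
  (\int[mu]_x (f x * h x)%:E = cst%:E * \int[leb]_t
    ((bexp u hd (lam ^+ 2) t)%:E *
     \int[mu]_x (gaussfun (expR (- t) / u) x * h x)%:E))%E.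
Proof.
move=> mh h0.
pose F (xt : T * measurableTypeR R) : \bar R :=
  ((bexp u hd (normsq xt.1 + lam ^+ 2) xt.2)%:E * (h xt.1)%:E)%E.
have mF : measurable_fun setT F.
  apply: emeasurable_funM => //.
  by apply/measurable_EFinP; exact: (measurableT_comp mh measurable_fst).
have F0 xt : ((0 : \bar R) <= F xt)%E by rewrite mule_ge0// lee_fin.
transitivity (\int[mu]_x (cst%:E * \int[leb]_t F (x, t)))%E.
  apply: eq_integral => x _; rewrite EFinM ndfhl_densityE -muleA; congr (_ * _)%E.
  rewrite -ge0_integralZr ?lee_fin//.
    by apply/measurable_EFinP; exact: measurable_bexp.
  by move=> t _; rewrite lee_fin ltW// bexp_gt0.
rewrite ge0_integralZl_EFin ?(ltW cst_gt0)//; last 2 first.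
- by move=> x _; apply: integral_ge0.
- exact: (@measurable_fun_fubini_tonelli_F _ _ _ _ _ leb F mF F0).
congr (_ * _)%E; rewrite (fubini_tonelli (m2 := leb) F mF F0).
apply: eq_integral => t _; rewrite -ge0_integralZl_EFin ?ltW ?bexp_gt0//.
- by apply: eq_integral => x _; rewrite /F/= bexpE -!EFinM mulrA.
- by move=> x _; rewrite lee_fin mulr_ge0// ltW// gaussfun_gt0.
- by apply/measurable_EFinP/measurable_funM => //; exact: measurable_gaussfun.
Qed.

Let sqrt_expR t : Num.sqrt (2 * pi * (expR (- t) / u)) ^+ n.+1 =
  Num.sqrt (2 * pi / u) ^+ n.+1 * expR (- (n.+1%:R / 2 * t)).
Proof.
have -> : 2 * pi * (expR (- t) / u) = 2 * pi / u * expR (- (t / 2)) ^+ 2.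
  rewrite expr2 -expRD (_ : - (t / 2) + - (t / 2) = - t); last by field.
  by field; rewrite gt_eqF.
rewrite sqrtrM ?divr_ge0 ?mulr_ge0 ?pi_ge0 ?(ltW u0)// sqrtr_sqr.
rewrite ger0_norm ?expR_ge0// exprMn -expRM_natl; congr (_ * expR _).
by field.
Qed.

(** The Gaussian mass contributes exp (- (d - 1) t / 2), leaving 1/2 of the exponent d / 2: this is
    why one closed form serves every dimension. *)
Let bexp_expR t : bexp u hd (lam ^+ 2) t * expR (- (n.+1%:R / 2 * t)) =
  bexp u 2^-1 (lam ^+ 2) t.
Proof.
by rewrite /bexp -expRD; congr expR; rewrite /hd -(addn1 n.+1) natrD; field.
Qed.

Let s_gt0 t : 0 < expR (- t) / u.
Proof. by rewrite divr_gt0 ?expR_gt0. Qed.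

Lemma integral_ndfhl_density : (\int[mu]_x (f x)%:E = 1)%E.
Proof.
have := @integral_ndfhl (fun=> 1) (measurable_cst _) (fun=> ler01).
under eq_integral do rewrite mulr1.
move=> ->; under eq_integral => t _.
  under eq_integral do rewrite mulr1.
  rewrite integral_gaussfun// -EFinM sqrt_expR mulrCA bexp_expR EFinM.
  over.
rewrite ge0_integralZl_EFin ?exprn_ge0 ?sqrtr_ge0//; last 2 first.
- by move=> t _; rewrite lee_fin ltW// bexp_gt0.
- by apply/measurable_EFinP; exact: measurable_bexp.
rewrite integral_bexp_half// -!EFinM; congr EFin.
transitivity (cst * Num.sqrt (2 * pi / u) ^+ n.+2 / lam * expR (- (lam * u))).
  by rewrite (exprSr _ n.+1); ring.
by rewrite cstE expRN; field; rewrite !gt_eqF// expR_gt0.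
Qed.

(** The Gaussian second moment brings a further factor exp (- t), which moves the exponent from 1/2
    to - 1/2, where the integral is still finite. *)
Lemma ndfhl_density_mom : exists c : R, (\int[mu]_x (f x * normsq x)%:E = c%:E)%E.
Proof.
have b0 a t : ((0 : \bar R) <= (bexp u a (lam ^+ 2) t)%:E)%E.
  by rewrite lee_fin ltW// bexp_gt0.
have Jfin : (\int[leb]_t (bexp u (- 2^-1) (lam ^+ 2) t)%:E)%E \is a fin_num.
  rewrite ge0_fin_numE; first by rewrite integral_bexp_lty// exprn_gt0.
  by apply: integral_ge0 => t _; exact: b0.
pose k := Num.sqrt (2 * pi / u) ^+ n.+1 * (n.+1%:R / u).
have k0 : 0 <= k by rewrite mulr_ge0 ?exprn_ge0 ?sqrtr_ge0// divr_ge0// ltW.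
exists (cst * (k * fine (\int[leb]_t (bexp u (- 2^-1) (lam ^+ 2) t)%:E))).
rewrite integral_ndfhl; [|exact: measurable_normsq|exact: normsq_ge0].
rewrite (EFinM cst) (EFinM k) fineK//; congr (_ * _)%E.
rewrite -ge0_integralZl_EFin//; last first.
  by apply/measurable_EFinP; exact: measurable_bexp.
apply: eq_integral => t _.
have G0 := gaussd_cst_gt0 n.+1 (s_gt0 t).
have -> : (\int[mu]_x (gaussfun (expR (- t) / u) x * normsq x)%:E =
    (Num.sqrt (2 * pi * (expR (- t) / u)) ^+ n.+1 * (n.+1%:R * (expR (- t) / u)))%:E)%E.
  rewrite (EFinM _ (n.+1%:R * _)) -integral_normsq_gaussd// -ge0_integralZl_EFin ?(ltW G0)//.
  - apply: eq_integral => x _; rewrite -EFinM /gaussd; congr EFin.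
    by field; rewrite gt_eqF// -exprnP.
  - by move=> x _; rewrite lee_fin mulr_ge0 ?normsq_ge0// ltW// gaussd_gt0.
  - apply/measurable_EFinP/measurable_funM; first exact: measurable_normsq.
    exact: measurable_gaussd.
rewrite -!EFinM; congr EFin; rewrite sqrt_expR /k.
transitivity (Num.sqrt (2 * pi / u) ^+ n.+1 * (n.+1%:R / u) *
    (bexp u hd (lam ^+ 2) t * expR (- (n.+1%:R / 2 * t)) * expR (- t))).
  by ring.
rewrite bexp_expR; congr (_ * _); rewrite /bexp -expRD; congr expR; by field.
Qed.

(** Keep only t in [0, 1] of the mixture, where exp t <= e, exp (- t) <= 1 and the linear term is
    nonnegative. *)
Lemma ndfhl_density_ge (x : T) :
  cst * expR (- (u / 2 * (lam ^+ 2 * expR 1 + 1))) *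
    expR (- (u / 2 * expR 1 * normsq x)) <= f x.
Proof.
rewrite -lee_fin ndfhl_densityE -(mulrA cst) (EFinM cst) lee_wpmul2l ?lee_fin ?(ltW cst_gt0)//.
rewrite -expRD; set k := expR _.
have mb : measurable_fun setT (fun t => (bexp u hd (normsq x + lam ^+ 2) t)%:E).
  by apply/measurable_EFinP; exact: measurable_bexp.
have b0 t : ((0 : \bar R) <= (bexp u hd (normsq x + lam ^+ 2) t)%:E)%E.
  by rewrite lee_fin ltW// bexp_gt0.
apply: (@le_trans _ _ (\int[leb]_(t in `[0%R, 1%R]%classic)
    (bexp u hd (normsq x + lam ^+ 2) t)%:E)%E); last first.
  by apply: ge0_subset_integral => //; exact: measurable_itv.
apply: (@le_trans _ _ (\int[leb]_(t in `[0%R, 1%R]%classic) k%:E)%E).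
  rewrite integral_cst; last exact: measurable_itv.
  by rewrite /= lebesgue_measure_itv/= lte01 oppr0 adde0 mule1.
apply: ge0_le_integral => //.
- by move=> t _; rewrite lee_fin expR_ge0.
- exact: measurable_funTS.
move=> t; rewrite /= in_itv/= => /andP[t0 t1].
rewrite lee_fin ler_expR -opprD.
have e1 : expR t <= expR 1 by rewrite ler_expR.
have e2 : expR (- t) <= 1 by rewrite -expR0 ler_expR oppr_le0.
have h1 : (normsq x + lam ^+ 2) * expR t <= (normsq x + lam ^+ 2) * expR 1.
  by rewrite ler_wpM2l// addr_ge0 ?normsq_ge0 ?sqr_ge0.
have h2 : u / 2 * ((normsq x + lam ^+ 2) * expR t + expR (- t)) <=
    u / 2 * ((normsq x + lam ^+ 2) * expR 1 + 1).
  by rewrite ler_pM2l ?divr_gt0// lerD.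
have h3 : 0 <= hd * t by exact: mulr_ge0.
have -> : u / 2 * (lam ^+ 2 * expR 1 + 1) + u / 2 * expR 1 * normsq x =
    u / 2 * ((normsq x + lam ^+ 2) * expR 1 + 1) by ring.
by lra.
Qed.

Lemma ndfhl_density_gt0 (x : T) : 0 < f x.
Proof.
apply: lt_le_trans (ndfhl_density_ge x).
by apply: mulr_gt0 (expR_gt0 _); exact: mulr_gt0 cst_gt0 (expR_gt0 _).
Qed.

(** Each Gaussian of the mixture is largest at x = 0. The maximum with 1 makes ln M nonnegative. *)
Lemma ndfhl_density_le : exists M : R, 1 <= M /\ forall x : T, f x <= M.
Proof.
have l20 : 0 < lam ^+ 2 by rewrite exprn_gt0.
pose J := (\int[leb]_t (bexp u hd (lam ^+ 2) t)%:E)%E.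
have J0 : (0 <= J)%E by apply: integral_ge0 => t _; rewrite lee_fin ltW// bexp_gt0.
have Jfin : J \is a fin_num by rewrite ge0_fin_numE// integral_bexp_lty.
exists (Num.max 1 (cst * fine J)); split => [|x]; first by rewrite le_max lexx.
rewrite le_max; apply/orP; right.
rewrite -lee_fin ndfhl_densityE (EFinM cst) fineK// lee_wpmul2l ?lee_fin ?(ltW cst_gt0)//.
apply: ge0_le_integral => //.
- by move=> t _; rewrite lee_fin ltW// bexp_gt0.
- by apply/measurable_EFinP; exact: measurable_bexp.
- by apply/measurable_EFinP; exact: measurable_bexp.
move=> t _; rewrite lee_fin bexpE ger_pMr ?bexp_gt0// /gaussfun -expR0 ler_expR.
by rewrite oppr_le0 divr_ge0 ?normsq_ge0// mulr_ge0// ltW.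
Qed.

End ndfhl.

Theorem theorem2 (R : realType) (d : nat) (lam u : R) :
  (2 <= d)%N -> 0 < lam -> 0 < u ->
  let p := d.-1 in
  let f := @ndfhl_density R d lam u in
  let cstar : \bar R :=
    ((p%:R / 2 * ln (2 * pi * expR 1 / p%:R))%:E - diff_entropy f)%E in
  (capacity f P - ((p%:R / 2 * ln P)%:E + cstar))%E @[P --> +oo%R] --> 0%E.
Proof.
(* With d = n.+2 the dimension is n.+1, positive as the comparison of [lebesgue_p] with [tleb]
   requires. *)
case: d => [//|[//|n]] _ lam0 u0 /=.
have [M [M1 fM]] := @ndfhl_density_le R n lam u lam0 u0.
have [c fc] := @ndfhl_density_mom R n lam u lam0 u0.
apply: (capacity_asymptotics _ _ fM M1 _ fc _ _ (ndfhl_density_ge lam0 u0)).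
- exact: measurable_ndfhl_density.
- exact: ndfhl_density_gt0.
- exact: integral_ndfhl_density.
- by rewrite !(divr_gt0, mulr_gt0) ?powR_gt0 ?pi_gt0 ?expR_gt0.
- by rewrite mulr_ge0 ?expR_ge0// divr_ge0// ltW.
Qed.
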